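(* Let $\Omega\subset\mathbb{C}$ be a hyperbolic domain whose boundary is uniformly perfect. Then the hyperbolic density $\lambda_\Omega$ and the density $\overline{\eta}_\Omega$ are bi-Lipschitz equivalent in $\Omega$; that is, there exists a constant $C\geq 1$ such that for all $w\in\Omega$ $$\frac{1}{C}\,\lambda_\Omega(w)\leq\overline{\eta}_\Omega(w)\leq C\,\lambda_\Omega(w).$$
   Context: A domain is a nonempty open connected subset of $\mathbb{C}$; a domain $\Omega\subset\mathbb{C}$ is hyperbolic if its complement $\Omega^c=\mathbb{C}\setminus\Omega$ contains at least two points. $\mathbb{D}=\{z\in\mathbb{C}:|z|<1\}$ and $\mathbb{D}^*=\mathbb{D}\setminus\{0\}$. For $w\in\Omega$, $\delta_\Omega(w)=\inf_{p\in\Omega^c}|w-p|$. Hyperbolic density: for a hyperbolic domain $\Omega$, $\lambda_\Omega$ is the density of constant curvature $-1$ determined by $\lambda_\Omega(f(z))\,|f'(z)|=\dfrac{2}{1-|z|^2}$ for $z\in\mathbb{D}$, where $f:\mathbb{D}\to\Omega$ is any holomorphic universal covering map (the definition does not depend on $f$). Uniformly perfect boundary: the boundary of a hyperbolic domain $\Omega$ is called uniformly perfect if there is a constant $b>0$ such that $\lambda_\Omega(w)\geq b/\delta_\Omega(w)$ for all $w\in\Omega$. Hurwitz density: for a domain $\Omega\subsetneq\mathbb{C}$ and $w\in\Omega$, let $\mathcal{H}_0^w(\mathbb{D},\Omega)$ be the collection of all holomorphic functions $f:\mathbb{D}\to\Omega$ such that $f(0)=w$, $f(s)\neq w$ for all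 $s\in\mathbb{D}^*$, and $f'(0)>0$. Put $r_\Omega(w)=\max\{f'(0): f\in\mathcal{H}_0^w(\mathbb{D},\Omega)\}$ (the maximum is known to exist) and $\eta_\Omega(w)=2/r_\Omega(w)$. For a hyperbolic domain $\Omega$ and $w\in\Omega$, $$\overline{\eta}_\Omega(w)=\sup\,\eta_{\mathbb{C}\setminus\{w_1,w_2\}}(w),$$ where the supremum is taken over all pairs of distinct points $w_1,w_2\in\Omega^c$. *)

(* Defs.v *)
From Stdlib Require Import Reals ClassicalEpsilon.
From Coquelicot Require Import Coquelicot.

Open Scope R_scope.

(** Subsets of the plane are predicates [C -> Prop].  Maps between subsets are
    total functions [C -> C], of which only the values on the source matter. *)

Definition connected (E : C -> Prop) : Prop :=
  forall U V : C -> Prop,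
    open U -> open V ->
    (forall z, E z -> U z \/ V z) ->
    (forall z, E z -> ~ (U z /\ V z)) ->
    (exists z, E z /\ U z) -> ~ (exists z, E z /\ V z).

Definition domain (Omega : C -> Prop) : Prop :=
  (exists w, Omega w) /\ open Omega /\ connected Omega.

Definition hyperbolic_domain (Omega : C -> Prop) : Prop :=
  domain Omega /\
  exists p q : C, p <> q /\ ~ Omega p /\ ~ Omega q.

Definition unit_disc (z : C) : Prop := Cmod z < 1.

Definition boundary_distance (Omega : C -> Prop) (w : C) : R :=
  real (Glb_Rbar (fun d => exists p, ~ Omega p /\ d = Cmod (w - p)%C)).

(** [ex_derive] on [C -> C] is complex differentiability. *)
Definition holomorphic_on (U : C -> Prop) (f : C -> C) : Prop :=
  forall z, U z -> ex_derive f z.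

Definition maps_to (f : C -> C) (A B : C -> Prop) : Prop :=
  forall z, A z -> B (f z).

(** Continuity is that of the ambient plane; the notion is meant for open [A]
    and [B], where this agrees with the subspace topologies. *)
Definition homeomorphism_on (f : C -> C) (A B : C -> Prop) : Prop :=
  maps_to f A B /\
  (forall z, A z -> continuous f z) /\
  exists g : C -> C,
    maps_to g B A /\
    (forall u, B u -> continuous g u) /\
    (forall z, A z -> g (f z) = z) /\
    (forall u, B u -> f (g u) = u).

Definition evenly_covered (f : C -> C) (D U : C -> Prop) : Prop :=
  exists (I : Type) (sheet : I -> C -> Prop),
    (forall i, open (sheet i)) /\
    (forall i j z, sheet i z -> sheet j z -> i = j) /\
    (forall z, D z /\ U (f z) <-> exists i, sheet i z) /\
    (forall i, homeomorphism_on f (sheet i) U).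

Definition covering_map (f : C -> C) (D Omega : C -> Prop) : Prop :=
  maps_to f D Omega /\
  (forall w, Omega w -> exists z, D z /\ f z = w) /\
  (forall w, Omega w ->
     exists U : C -> Prop,
       open U /\ U w /\ (forall u, U u -> Omega u) /\ evenly_covered f D U).

(** The disc is simply connected, so a covering by the disc is universal. *)
Definition holomorphic_universal_covering (f : C -> C) (Omega : C -> Prop)
  : Prop :=
  holomorphic_on unit_disc f /\ covering_map f unit_disc Omega.

Definition is_hyperbolic_density_at (Omega : C -> Prop) (w : C) (l : R)
  : Prop :=
  exists (f : C -> C) (z : C),
    holomorphic_universal_covering f Omega /\ unit_disc z /\ f z = w /\
    l * Cmod (C_derive f z) = 2 / (1 - Cmod z ^ 2).

(** On a hyperbolic domain exactly one number satisfies
    [is_hyperbolic_density_at], because a universal covering by the disc exists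
    and the value depends neither on it nor on the preimage [z].  The value 0
    is used only off the domain or on plane sets which are not hyperbolic
    domains. *)
Definition hyperbolic_density (Omega : C -> Prop) (w : C) : R :=
  match excluded_middle_informative
          (exists l, is_hyperbolic_density_at Omega w l) with
  | left H => proj1_sig (constructive_indefinite_description _ H)
  | right _ => 0
  end.

Definition uniformly_perfect_boundary (Omega : C -> Prop) : Prop :=
  exists b : R, 0 < b /\
    forall w, Omega w ->
      hyperbolic_density Omega w >= b / boundary_distance Omega w.

(** [f] belongs to the Hurwitz family of [Omega] at [w] and [f'(0) = r];
    [r] being real and positive expresses [f'(0) > 0]. *)
Definition hurwitz_family (Omega : C -> Prop) (w : C) (f : C -> C) (r : R)
  : Prop :=
  holomorphic_on unit_disc f /\
  maps_to f unit_disc Omega /\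
  f (RtoC 0) = w /\
  (forall s, unit_disc s -> s <> RtoC 0 -> f s <> w) /\
  C_derive f (RtoC 0) = RtoC r /\ 0 < r.

(** For [Omega] different from the plane this set of derivatives has a
    maximum, which is therefore its least upper bound. *)
Definition hurwitz_radius (Omega : C -> Prop) (w : C) : R :=
  real (Lub_Rbar (fun r => exists f, hurwitz_family Omega w f r)).

Definition hurwitz_density (Omega : C -> Prop) (w : C) : R :=
  2 / hurwitz_radius Omega w.

Definition twice_punctured_plane (w1 w2 : C) : C -> Prop :=
  fun z => z <> w1 /\ z <> w2.

(** The supremum is taken in the extended reals. *)
Definition eta_bar (Omega : C -> Prop) (w : C) : Rbar :=
  Lub_Rbar (fun h => exists w1 w2 : C,
    w1 <> w2 /\ ~ Omega w1 /\ ~ Omega w2 /\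
    h = hurwitz_density (twice_punctured_plane w1 w2) w).

(* Main.v *)
Require Import Defs.
From Stdlib Require Import Reals Lra Lia Classical ClassicalEpsilon.
From Coquelicot Require Import Coquelicot.
Open Scope R_scope.

(** Write [d] for the distance from [w] to the complement of [Omega].  Both
    densities are comparable with [1 / d], the constants depending on the
    constant [b] of uniform perfectness only.

    The bound [lambda >= b / d] is the hypothesis.  It also shows that [lambda] is
    positive, which by definition of [lambda] provides a universal covering [f] by
    the disc.  For [lambda <= 4 / d], the affine map of
    the unit disc onto the disc of radius [d] round [w] lifts through [f]
    ([disc_lift]), the lift is holomorphic because [f] has no critical points
    ([covering_derivative_neq_0]), and the Schwarz-Pick lemma bounds the
    derivative of the lift ([covering_derivative_bound]).

    For [eta_bar], the affine map just used belongs to every Hurwitz family in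
    question, whence [eta_bar <= 2 / d].  The opposite bound is Hurwitz's theorem
    ([hurwitz_bound]): if [f] takes the value [w] only at the origin and omits
    [p], then [|f' 0| <= 32 |w - p|].  Apply it with a puncture [p]
    nearly closest to [w].

    Hurwitz's theorem is proved by a Landen iteration.  Normalize to [w = 0],
    [p = 1], so that [f = c z + ...] vanishes only at the origin and omits [1].
    With [s = sqrt (1 - f)], the function [((1 - s) / (1 + s)) ^ 2] has the same
    two properties, but a double zero with coefficient [c ^ 2 / 16].  After [k]
    steps the zero has order [n = 2 ^ k] and coefficient of modulus
    [16 (|c| / 16) ^ n], while on the circle [|z| = 1 / 2] the function and its
    reciprocal are bounded by [B ^ n] with [B] independent of [k].  The [n]-th root
    [S] of one minus the function is then bounded by [B], and the maximum
    principle for [(S - 1) / z ^ n] gives [16 (|c| / 16) ^ n <= n (B + 1) 2 ^ n].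
    As [n] tends to infinity, this forces [|c| <= 32].

    All the function theory comes from one fact ([centre_maximum_principle]): if a
    function is differentiable in a punctured disc and has a limit at the centre,
    its maximum modulus on the circle bounds that limit.  This follows from
    Goursat's theorem on rectangles, applied in the coordinate [log z], where
    circles become vertical segments. *)

(** * Limits and complex derivatives *)

(** The limit ignores the value at [a] itself, so that difference quotients and
    quotients by powers of [z] can be treated as functions on the plane. *)
Definition tends (f : C -> C) (a l : C) : Prop :=
  forall eps, 0 < eps -> exists delta, 0 < delta /\
    forall z, z <> a -> Cmod (z - a) < delta -> Cmod (f z - l) < eps.

Lemma locally_Cmod (a : C) (P : C -> Prop) :
  locally a P <->
  exists delta, 0 < delta /\ forall z, Cmod (z - a) < delta -> P z.
Proof.
  split.
  - intros [e He]. exists e. split; [apply cond_pos|].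
    intros z Hz. apply He. now apply C_NormedModule_mixin_compat1.
  - intros (d & Hd & H).
    assert (H2 : 0 < sqrt 2) by (apply sqrt_lt_R0; lra).
    assert (Hp : 0 < d / sqrt 2) by (apply Rdiv_lt_0_compat; lra).
    exists (mkposreal _ Hp). intros z Hz. apply H.
    generalize (C_NormedModule_mixin_compat2 a z (mkposreal _ Hp) Hz). simpl.
    replace (sqrt 2 * (d / sqrt 2)) with d by (field; lra). now intros.
Qed.

Lemma open_Cmod (U : C -> Prop) :
  open U <->
  forall a, U a -> exists delta, 0 < delta /\ forall z, Cmod (z - a) < delta -> U z.
Proof.
  split; intros H a Ha; apply locally_Cmod; now apply H.
Qed.

Lemma continuous_tends (f : C -> C) (a : C) :
  continuous f a <-> tends f a (f a).
Proof.
  split.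
  - intros H eps He.
    assert (Hl : locally (f a) (fun y => Cmod (y - f a) < eps)).
    { apply locally_Cmod. exists eps. now split. }
    destruct (proj1 (locally_Cmod _ _) (H _ Hl)) as (d & Hd & HH).
    exists d. split; [assumption|]. intros z _ Hz. now apply HH.
  - intros H P HP.
    destruct (proj1 (locally_Cmod _ _) HP) as (e & He & HH).
    destruct (H e He) as (d & Hd & Hf).
    apply locally_Cmod. exists d. split; [assumption|].
    intros z Hz. apply HH. destruct (classic (z = a)) as [->|Hza].
    + replace (f a - f a)%C with (RtoC 0) by ring. now rewrite Cmod_0.
    + now apply Hf.
Qed.

Lemma continuous_Cmod (f : C -> C) (a : C) :
  continuous f a ->
  forall eps, 0 < eps -> exists delta, 0 < delta /\
    forall z, Cmod (z - a) < delta -> Cmod (f z - f a) < eps.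
Proof.
  intros H eps He.
  assert (Hl : locally (f a) (fun y => Cmod (y - f a) < eps)).
  { apply locally_Cmod. exists eps. now split. }
  exact (proj1 (locally_Cmod _ _) (H _ Hl)).
Qed.

Lemma tends_ext (f g : C -> C) (a l : C) :
  (exists delta, 0 < delta /\
     forall z, z <> a -> Cmod (z - a) < delta -> f z = g z) ->
  tends f a l -> tends g a l.
Proof.
  intros (d1 & Hd1 & Hfg) H eps He. destruct (H eps He) as (d2 & Hd2 & Hf).
  exists (Rmin d1 d2). split; [now apply Rmin_pos|].
  intros z Hz Hlt. rewrite <- Hfg; [|assumption|].
  - apply Hf; [assumption|]. eapply Rlt_le_trans; [exact Hlt|apply Rmin_r].
  - eapply Rlt_le_trans; [exact Hlt|apply Rmin_l].
Qed.

Lemma tends_ext_all (f g : C -> C) (a l : C) :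
  (forall z, z <> a -> f z = g z) -> tends f a l -> tends g a l.
Proof.
  intros H. apply tends_ext. exists 1. split; [lra|]. intros; now apply H.
Qed.

Lemma tends_eq (f : C -> C) (a l m : C) : l = m -> tends f a l -> tends f a m.
Proof. now intros ->. Qed.

Lemma tends_const (a l : C) : tends (fun _ => l) a l.
Proof.
  intros eps He. exists 1. split; [lra|]. intros z _ _.
  replace (l - l)%C with (RtoC 0) by ring. now rewrite Cmod_0.
Qed.

Lemma tends_id (a : C) : tends (fun z => z) a a.
Proof. intros eps He. exists eps. split; [assumption|]. now intros. Qed.

Lemma tends_both (f g : C -> C) (a l m : C) :
  tends f a l -> tends g a m ->
  forall eps, 0 < eps -> exists delta, 0 < delta /\
    forall z, z <> a -> Cmod (z - a) < delta ->
      Cmod (f z - l) < eps /\ Cmod (g z - m) < eps.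
Proof.
  intros Hf Hg eps He.
  destruct (Hf eps He) as (d1 & Hd1 & H1). destruct (Hg eps He) as (d2 & Hd2 & H2).
  exists (Rmin d1 d2). split; [now apply Rmin_pos|].
  intros z Hz Hlt. split; [apply H1|apply H2]; try assumption;
    (eapply Rlt_le_trans; [exact Hlt|]); [apply Rmin_l|apply Rmin_r].
Qed.

Lemma tends_plus (f g : C -> C) (a l m : C) :
  tends f a l -> tends g a m -> tends (fun z => f z + g z)%C a (l + m)%C.
Proof.
  intros Hf Hg eps He.
  destruct (tends_both _ _ _ _ _ Hf Hg (eps / 2)) as (d & Hd & H); [lra|].
  exists d. split; [assumption|]. intros z Hz Hlt.
  destruct (H z Hz Hlt) as [H1 H2].
  replace (f z + g z - (l + m))%C with ((f z - l) + (g z - m))%C by ring.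
  eapply Rle_lt_trans; [apply Cmod_triangle|lra].
Qed.

Lemma tends_mult (f g : C -> C) (a l m : C) :
  tends f a l -> tends g a m -> tends (fun z => f z * g z)%C a (l * m)%C.
Proof.
  intros Hf Hg eps He.
  assert (Hl := Cmod_ge_0 l). assert (Hm := Cmod_ge_0 m).
  set (k := 1 + Cmod l + Cmod m). assert (Hk : 0 < k) by (unfold k; lra).
  assert (Hek : 0 < eps / k) by now apply Rdiv_lt_0_compat.
  destruct (tends_both _ _ _ _ _ Hf Hg (Rmin 1 (eps / k))) as (d & Hd & H).
  { apply Rmin_pos; lra. }
  exists d. split; [assumption|]. intros z Hz Hlt.
  destruct (H z Hz Hlt) as [H1 H2].
  replace (f z * g z - l * m)%C
    with (((f z - l) * (g z - m) + l * (g z - m)) + m * (f z - l))%C by ring.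
  eapply Rle_lt_trans; [apply Cmod_triangle|].
  eapply Rle_lt_trans; [apply Rplus_le_compat_r, Cmod_triangle|].
  rewrite !Cmod_mult.
  assert (Ha := Cmod_ge_0 (f z - l)). assert (Hb := Cmod_ge_0 (g z - m)).
  assert (H3 := Rmin_l 1 (eps / k)). assert (H4 := Rmin_r 1 (eps / k)).
  replace eps with (eps / k * k) by (field; lra).
  set (e := eps / k) in *. unfold k. clearbody e.
  assert (Cmod (f z - l) * Cmod (g z - m) <= 1 * Cmod (g z - m))
    by (apply Rmult_le_compat_r; lra).
  assert (Cmod l * Cmod (g z - m) <= Cmod l * e) by (apply Rmult_le_compat_l; lra).
  assert (Cmod m * Cmod (f z - l) <= Cmod m * e) by (apply Rmult_le_compat_l; lra).
  lra.
Qed.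

Lemma tends_opp (f : C -> C) (a l : C) :
  tends f a l -> tends (fun z => - f z)%C a (- l)%C.
Proof.
  intros H eps He. destruct (H eps He) as (d & Hd & HH).
  exists d. split; [assumption|]. intros z Hz Hlt.
  replace (- f z - - l)%C with (- (f z - l))%C by ring.
  rewrite Cmod_opp. now apply HH.
Qed.

Lemma tends_minus (f g : C -> C) (a l m : C) :
  tends f a l -> tends g a m -> tends (fun z => f z - g z)%C a (l - m)%C.
Proof. intros Hf Hg. apply tends_plus; [assumption|now apply tends_opp]. Qed.

Lemma tends_inv (f : C -> C) (a l : C) :
  tends f a l -> l <> RtoC 0 -> tends (fun z => / f z)%C a (/ l)%C.
Proof.
  intros Hf Hl eps He. assert (Hp := proj1 (Cmod_gt_0 l) Hl).
  assert (H2 : 0 < eps * (Cmod l * Cmod l) / 2).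
  { repeat (apply Rmult_lt_0_compat || lra). }
  destruct (Hf (Rmin (Cmod l / 2) (eps * (Cmod l * Cmod l) / 2))) as (d & Hd & H).
  { apply Rmin_pos; lra. }
  exists d. split; [assumption|]. intros z Hz Hlt. specialize (H z Hz Hlt).
  generalize (Rmin_l (Cmod l / 2) (eps * (Cmod l * Cmod l) / 2))
             (Rmin_r (Cmod l / 2) (eps * (Cmod l * Cmod l) / 2)). intros Ha Hb.
  assert (Hf2 : Cmod l / 2 < Cmod (f z)).
  { generalize (Cmod_triangle (f z) (- (f z - l))). rewrite Cmod_opp.
    replace (f z + - (f z - l))%C with l by ring. lra. }
  assert (Hfz : f z <> 0) by (apply Cmod_gt_0; lra).
  replace (/ f z - / l)%C with (- (f z - l) / (f z * l))%C by (field; now split).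
  rewrite Cmod_div, Cmod_opp, Cmod_mult by now apply Cmult_neq_0.
  apply Rmult_lt_reg_r with (Cmod (f z) * Cmod l); [nra|].
  unfold Rdiv. rewrite Rmult_assoc, Rinv_l, Rmult_1_r by nra.
  assert (eps * Cmod l * (Cmod l / 2) < eps * Cmod l * Cmod (f z))
    by (apply Rmult_lt_compat_l; [now apply Rmult_lt_0_compat|assumption]).
  lra.
Qed.

Lemma tends_div (f g : C -> C) (a l m : C) :
  tends f a l -> tends g a m -> m <> RtoC 0 ->
  tends (fun z => f z / g z)%C a (l / m)%C.
Proof. intros Hf Hg Hm. apply tends_mult; [assumption|now apply tends_inv]. Qed.

Lemma tends_comp (f g : C -> C) (a b : C) :
  tends g a b -> tends f b (f b) -> tends (fun z => f (g z)) a (f b).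
Proof.
  intros Hg Hf eps He. apply continuous_tends in Hf.
  destruct (continuous_Cmod _ _ Hf eps He) as (e & Hpe & H).
  destruct (Hg e Hpe) as (d & Hd & H2).
  exists d. split; [assumption|]. intros z Hz Hlt. apply H. now apply H2.
Qed.

Lemma Cminus_neq_0 (z a : C) : z <> a -> (z - a)%C <> RtoC 0.
Proof. intros Hz E. apply Hz. replace z with (z - a + a)%C by ring. rewrite E. ring. Qed.

(** The derivative is taken along the neighbourhoods given by the modulus, the
    other notions along those of the product [R * R]. *)
Lemma locally_AbsRing_Cmod (a : C) (P : C -> Prop) :
  locally (T := AbsRing_UniformSpace C_AbsRing) a P <->
  exists delta, 0 < delta /\ forall z, Cmod (z - a) < delta -> P z.
Proof.
  split.
  - intros [e He]. exists e. split; [apply cond_pos|]. exact He.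
  - intros (d & Hd & H). exists (mkposreal d Hd). exact H.
Qed.

Lemma is_derive_tends (f : C -> C) (a l : C) :
  is_derive f a l <-> tends (fun z => (f z - f a) / (z - a))%C a l.
Proof.
  split.
  - intros [_ H] eps He. specialize (H a (fun P HP => HP)).
    assert (He2 : 0 < eps / 2) by lra.
    specialize (H (mkposreal _ He2)).
    destruct (proj1 (locally_AbsRing_Cmod _ _) H) as (d & Hd & HH).
    exists d. split; [assumption|]. intros z Hz Hlt. specialize (HH z Hlt).
    assert (Hm : 0 < Cmod (z - a)) by now apply Cmod_gt_0, Cminus_neq_0.
    change (Cmod (f z - f a - (z - a) * l) <= eps / 2 * Cmod (z - a)) in HH.
    replace ((f z - f a) / (z - a) - l)%C
      with ((f z - f a - (z - a) * l) / (z - a))%C by (field; now apply Cminus_neq_0).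
    rewrite Cmod_div by now apply Cminus_neq_0.
    apply Rmult_lt_reg_r with (Cmod (z - a)); [assumption|].
    unfold Rdiv. rewrite Rmult_assoc, Rinv_l, Rmult_1_r by lra. nra.
  - intros H. split; [apply is_linear_scal_l|].
    intros x Hx. assert (E : a = x)
      by exact (is_filter_lim_locally_unique (V := AbsRing_NormedModule C_AbsRing) a x Hx).
    subst x. intros [eps He]. destruct (H eps He) as (d & Hd & HH).
    apply locally_AbsRing_Cmod. exists d. split; [assumption|]. intros z Hlt.
    change (Cmod (f z - f a - (z - a) * l) <= eps * Cmod (z - a)).
    destruct (classic (z = a)) as [->|Hz].
    + replace (f a - f a - (a - a) * l)%C with (RtoC 0) by ring.
      rewrite Cmod_0. generalize (Cmod_ge_0 (a - a)). nra.
    + specialize (HH z Hz Hlt).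
      assert (Hm : 0 < Cmod (z - a)) by now apply Cmod_gt_0, Cminus_neq_0.
      replace (f z - f a - (z - a) * l)%C
        with (((f z - f a) / (z - a) - l) * (z - a))%C by (field; now apply Cminus_neq_0).
      rewrite Cmod_mult. nra.
Qed.

Lemma is_derive_continuous (f : C -> C) (a l : C) :
  is_derive f a l -> tends f a (f a).
Proof.
  intros H. apply is_derive_tends in H.
  apply tends_eq with (l * (a - a) + f a)%C; [ring|].
  apply tends_ext_all with (fun z => (f z - f a) / (z - a) * (z - a) + f a)%C.
  - intros z Hz. field. now apply Cminus_neq_0.
  - apply tends_plus; [apply tends_mult|apply tends_const]; [assumption|].
    apply tends_minus; [apply tends_id|apply tends_const].
Qed.

(** ** Rules of differentiation *)

Lemma is_derive_ext_near (f g : C -> C) (a l : C) :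
  (exists delta, 0 < delta /\ forall z, Cmod (z - a) < delta -> f z = g z) ->
  is_derive f a l -> is_derive g a l.
Proof.
  intros (d & Hd & E) H. apply is_derive_tends. apply is_derive_tends in H.
  revert H. apply tends_ext. exists d. split; [assumption|].
  intros z Hz Hlt. rewrite !E; [reflexivity| |assumption].
  replace (a - a)%C with (RtoC 0) by ring. now rewrite Cmod_0.
Qed.

Lemma is_C_derive_const (c a : C) : is_derive (fun _ : C => c) a (RtoC 0).
Proof.
  apply is_derive_tends. apply tends_ext_all with (fun _ => RtoC 0).
  - intros z Hz. field. now apply Cminus_neq_0.
  - apply tends_const.
Qed.

Lemma is_C_derive_id (a : C) : is_derive (fun z : C => z) a (RtoC 1).
Proof.
  apply is_derive_tends. apply tends_ext_all with (fun _ => RtoC 1).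
  - intros z Hz. field. now apply Cminus_neq_0.
  - apply tends_const.
Qed.

Lemma is_C_derive_plus (f g : C -> C) (a l m : C) :
  is_derive f a l -> is_derive g a m -> is_derive (fun z => f z + g z)%C a (l + m)%C.
Proof.
  intros Hf Hg. apply is_derive_tends. apply is_derive_tends in Hf, Hg.
  apply tends_ext_all
    with (fun z => (f z - f a) / (z - a) + (g z - g a) / (z - a))%C.
  - intros z Hz. field. now apply Cminus_neq_0.
  - now apply tends_plus.
Qed.

Lemma is_C_derive_mult (f g : C -> C) (a l m : C) :
  is_derive f a l -> is_derive g a m ->
  is_derive (fun z => f z * g z)%C a (l * g a + f a * m)%C.
Proof.
  intros Hf Hg. assert (Hc := is_derive_continuous _ _ _ Hg).
  apply is_derive_tends. apply is_derive_tends in Hf, Hg.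
  apply tends_ext_all
    with (fun z => (f z - f a) / (z - a) * g z + f a * ((g z - g a) / (z - a)))%C.
  - intros z Hz. field. now apply Cminus_neq_0.
  - apply tends_plus; apply tends_mult; try assumption. apply tends_const.
Qed.

Lemma is_C_derive_inv (f : C -> C) (a l : C) :
  is_derive f a l -> f a <> RtoC 0 ->
  is_derive (fun z => / f z)%C a (- (l / (f a * f a)))%C.
Proof.
  intros Hf H0. assert (Hc := is_derive_continuous _ _ _ Hf).
  apply is_derive_tends. apply is_derive_tends in Hf.
  apply tends_ext with (fun z => - ((f z - f a) / (z - a) / (f z * f a)))%C.
  - apply continuous_tends in Hc.
    destruct (continuous_Cmod _ _ Hc (Cmod (f a))) as (d & Hd & H).
    { now apply Cmod_gt_0. }
    exists d. split; [assumption|]. intros z Hz Hlt.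
    assert (f z <> 0).
    { intros E. specialize (H z Hlt). rewrite E in H.
      replace (0 - f a)%C with (- f a)%C in H by ring. rewrite Cmod_opp in H. lra. }
    field. repeat split; try assumption. now apply Cminus_neq_0.
  - apply tends_opp, tends_div; [assumption| |now apply Cmult_neq_0].
    apply tends_mult; [assumption|apply tends_const].
Qed.

(** The difference quotient of [f] at [b], extended continuously by [l].  It makes
    sense of the quotient along a path that returns to [b]. *)
Lemma difference_quotient_extension (f : C -> C) (b l : C) :
  tends (fun u => (f u - f b) / (u - b))%C b l ->
  exists phi : C -> C, phi b = l /\ tends phi b (phi b) /\
    forall u, (f u - f b)%C = (phi u * (u - b))%C.
Proof.
  intros Hf.
  exists (fun u => if excluded_middle_informative (u = b) then l
                   else ((f u - f b) / (u - b))%C).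
  destruct (excluded_middle_informative (b = b)) as [_|N]; [|now destruct N].
  split; [reflexivity|]. split.
  - revert Hf. apply tends_ext_all. intros u Hu.
    now destruct (excluded_middle_informative (u = b)).
  - intros u. destruct (excluded_middle_informative (u = b)) as [->|Hu].
    + ring.
    + field. now apply Cminus_neq_0.
Qed.

Lemma is_C_derive_comp (f g : C -> C) (a l m : C) :
  is_derive f (g a) l -> is_derive g a m ->
  is_derive (fun z => f (g z)) a (l * m)%C.
Proof.
  intros Hf Hg. assert (Hc := is_derive_continuous _ _ _ Hg).
  apply is_derive_tends. apply is_derive_tends in Hf, Hg.
  destruct (difference_quotient_extension f (g a) l Hf) as (phi & Hphi & Hcp & Hq).
  apply tends_ext_all with (fun z => phi (g z) * ((g z - g a) / (z - a)))%C.
  - intros z Hz. rewrite Hq. field. now apply Cminus_neq_0.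
  - apply tends_mult; [|assumption]. rewrite <- Hphi. now apply tends_comp.
Qed.

Lemma is_C_derive_affine (b k a : C) : is_derive (fun z => b + k * z)%C a k.
Proof.
  assert (H : is_derive (fun z => b + k * z)%C a (RtoC 0 + (RtoC 0 * a + k * RtoC 1))%C).
  { apply is_C_derive_plus; [apply is_C_derive_const|].
    apply is_C_derive_mult; [apply is_C_derive_const|apply is_C_derive_id]. }
  replace (RtoC 0 + (RtoC 0 * a + k * RtoC 1))%C with k in H by ring. exact H.
Qed.

Lemma ex_derive_const_C (c a : C) : ex_derive (fun _ : C => c) a.
Proof. eexists. apply is_C_derive_const. Qed.

Lemma ex_derive_id_C (a : C) : ex_derive (fun z : C => z) a.
Proof. eexists. apply is_C_derive_id. Qed.

Lemma ex_derive_plus_C (f g : C -> C) (a : C) :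
  ex_derive f a -> ex_derive g a -> ex_derive (fun z => f z + g z)%C a.
Proof. intros [l Hl] [m Hm]. eexists. apply is_C_derive_plus; eassumption. Qed.

Lemma ex_derive_mult_C (f g : C -> C) (a : C) :
  ex_derive f a -> ex_derive g a -> ex_derive (fun z => f z * g z)%C a.
Proof. intros [l Hl] [m Hm]. eexists. apply is_C_derive_mult; eassumption. Qed.

Lemma ex_derive_minus_C (f g : C -> C) (a : C) :
  ex_derive f a -> ex_derive g a -> ex_derive (fun z => f z - g z)%C a.
Proof.
  intros Hf [m Hm]. apply ex_derive_plus_C; [assumption|].
  eexists. apply is_derive_ext_near with (fun z => - RtoC 1 * g z)%C.
  - exists 1. split; [lra|]. intros. ring.
  - eapply is_C_derive_mult; [apply is_C_derive_const|eassumption].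
Qed.

Lemma ex_derive_div_C (f g : C -> C) (a : C) :
  ex_derive f a -> ex_derive g a -> g a <> RtoC 0 ->
  ex_derive (fun z => f z / g z)%C a.
Proof.
  intros Hf [m Hm] H0. apply ex_derive_mult_C; [assumption|].
  eexists. apply is_C_derive_inv; eassumption.
Qed.

Lemma ex_derive_comp_C (f g : C -> C) (a : C) :
  ex_derive f (g a) -> ex_derive g a -> ex_derive (fun z => f (g z)) a.
Proof. intros [l Hl] [m Hm]. eexists. apply is_C_derive_comp; eassumption. Qed.

Lemma ex_derive_pow_C (f : C -> C) (n : nat) (a : C) :
  ex_derive f a -> ex_derive (fun z => f z ^ n)%C a.
Proof.
  intros Hf. induction n as [|n IH]; simpl.
  - apply ex_derive_const_C.
  - now apply ex_derive_mult_C.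
Qed.

Lemma ex_derive_tends (f : C -> C) (a : C) : ex_derive f a -> tends f a (f a).
Proof. intros [l Hl]. exact (is_derive_continuous _ _ _ Hl). Qed.

(** * Goursat's theorem *)

Lemma nested_intervals (l r : nat -> R) :
  (forall n, l n <= l (S n)) -> (forall n, r (S n) <= r n) ->
  (forall n, l n <= r n) -> exists x, forall n, l n <= x <= r n.
Proof.
  intros Hl Hr Hlr.
  assert (Ml : forall n m, (n <= m)%nat -> l n <= l m).
  { intros n m H. induction H; [lra|]. generalize (Hl m). lra. }
  assert (Mr : forall n m, (n <= m)%nat -> r m <= r n).
  { intros n m H. induction H; [lra|]. generalize (Hr m). lra. }
  assert (Hcross : forall n m, l n <= r m).
  { intros n m. generalize (Ml n (Nat.max n m) (Nat.le_max_l _ _))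
      (Mr m (Nat.max n m) (Nat.le_max_r _ _)) (Hlr (Nat.max n m)). lra. }
  destruct (completeness (fun t => exists n, t = l n)) as [x [Hub Hleast]].
  - exists (r O). intros t [n ->]. apply Hcross.
  - exists (l O). now exists O.
  - exists x. intros n. split.
    + apply Hub. now exists n.
    + apply Hleast. intros t [m ->]. apply Hcross.
Qed.

(** Bisection: a property of rectangles that passes from the four quarters to the
    whole and holds for the small rectangles round each point holds for the given
    rectangle.  Otherwise some quarter is bad, a quarter of it is bad, and so on,
    and these shrink to a point where the local hypothesis fails. *)
Lemma rectangle_induction (P : R -> R -> R -> R -> Prop) (a b c d : R) :
  a <= b -> c <= d ->
  (forall a' b' c' d', a <= a' -> a' <= b' -> b' <= b -> c <= c' -> c' <= d' -> d' <= d ->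
     P a' ((a' + b') / 2) c' ((c' + d') / 2) ->
     P ((a' + b') / 2) b' c' ((c' + d') / 2) ->
     P a' ((a' + b') / 2) ((c' + d') / 2) d' ->
     P ((a' + b') / 2) b' ((c' + d') / 2) d' -> P a' b' c' d') ->
  (forall x y, a <= x <= b -> c <= y <= d -> exists delta, 0 < delta /\
     forall a' b' c' d', a <= a' -> a' <= x <= b' -> b' <= b ->
       c <= c' -> c' <= y <= d' -> d' <= d ->
       b' - a' < delta -> d' - c' < delta -> P a' b' c' d') ->
  P a b c d.
Proof.
  intros Hab Hcd Hsplit Hlocal. apply NNPP. intros Hbad.
  set (w n := (b - a) * (1 / 2) ^ n). set (h n := (d - c) * (1 / 2) ^ n).
  assert (Hpow : forall n, 0 < (1 / 2) ^ n) by (intros; apply pow_lt; lra).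
  assert (Hw : forall n, 0 <= w n /\ w (S n) = w n / 2).
  { intros n. unfold w. simpl. generalize (Hpow n). split; [|lra].
    apply Rmult_le_pos; lra. }
  assert (Hh : forall n, 0 <= h n /\ h (S n) = h n / 2).
  { intros n. unfold h. simpl. generalize (Hpow n). split; [|lra].
    apply Rmult_le_pos; lra. }
  (* [p] is the lower left corner of a rectangle of the [n]-th generation. *)
  set (Bad := fun (n : nat) (p : R * R) =>
    a <= fst p /\ fst p + w n <= b /\ c <= snd p /\ snd p + h n <= d /\
    ~ P (fst p) (fst p + w n) (snd p) (snd p + h n)).
  assert (Hnext : forall n (s : {p | Bad n p}), exists s' : {p | Bad (S n) p},
    (fst (proj1_sig s) <= fst (proj1_sig s') /\
     fst (proj1_sig s') + w (S n) <= fst (proj1_sig s) + w n) /\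
    (snd (proj1_sig s) <= snd (proj1_sig s') /\
     snd (proj1_sig s') + h (S n) <= snd (proj1_sig s) + h n)).
  { intros n [[x y] (H1 & H2 & H3 & H4 & H5)]. simpl in *.
    destruct (Hw n) as [Hw1 Hw2]. destruct (Hh n) as [Hh1 Hh2].
    assert (E1 : (x + (x + w n)) / 2 = x + w (S n)) by lra.
    assert (E2 : (y + (y + h n)) / 2 = y + h (S n)) by lra.
    assert (E3 : x + w n = x + w (S n) + w (S n)) by lra.
    assert (E4 : y + h n = y + h (S n) + h (S n)) by lra.
    destruct (classic (exists x' y', (x' = x \/ x' = x + w (S n)) /\
      (y' = y \/ y' = y + h (S n)) /\
      ~ P x' (x' + w (S n)) y' (y' + h (S n)))) as [(x' & y' & Hx & Hy & HP)|Hno].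
    - assert (HB : Bad (S n) (x', y')).
      { unfold Bad. simpl. repeat split; try assumption; destruct Hx, Hy; lra. }
      exists (exist _ _ HB). simpl. destruct Hx, Hy; lra.
    - exfalso. apply H5. apply Hsplit; try lra; rewrite ?E1, ?E2, ?E3, ?E4;
        apply NNPP; intros HP; apply Hno; eexists; eexists; (split; [|split; [|exact HP]]); auto. }
  assert (HB0 : Bad O (a, c)).
  { unfold Bad, w, h. simpl. rewrite !Rmult_1_r.
    replace (a + (b - a)) with b by ring. replace (c + (d - c)) with d by ring.
    repeat split; try lra. assumption. }
  set (seq := nat_rect (fun n => {p | Bad n p}) (exist _ _ HB0)
    (fun n s => proj1_sig (constructive_indefinite_description _ (Hnext n s)))).
  assert (Hseq : forall n,
    (fst (proj1_sig (seq n)) <= fst (proj1_sig (seq (S n))) /\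
     fst (proj1_sig (seq (S n))) + w (S n) <= fst (proj1_sig (seq n)) + w n) /\
    (snd (proj1_sig (seq n)) <= snd (proj1_sig (seq (S n))) /\
     snd (proj1_sig (seq (S n))) + h (S n) <= snd (proj1_sig (seq n)) + h n)).
  { intros n. exact (proj2_sig (constructive_indefinite_description _ (Hnext n (seq n)))). }
  destruct (nested_intervals (fun n => fst (proj1_sig (seq n)))
    (fun n => fst (proj1_sig (seq n)) + w n)) as [x Hx].
  { intros n. apply Hseq. } { intros n. apply Hseq. }
  { intros n. generalize (proj1 (Hw n)). lra. }
  destruct (nested_intervals (fun n => snd (proj1_sig (seq n)))
    (fun n => snd (proj1_sig (seq n)) + h n)) as [y Hy].
  { intros n. apply Hseq. } { intros n. apply Hseq. }
  { intros n. generalize (proj1 (Hh n)). lra. }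
  assert (Hin : forall n, Bad n (proj1_sig (seq n))) by (intros n; apply proj2_sig).
  destruct (Hlocal x y) as (delta & Hd & Hgood).
  { generalize (Hx O) (Hin O). unfold Bad. lra. }
  { generalize (Hy O) (Hin O). unfold Bad. lra. }
  assert (Hk : 0 < 1 + (b - a) + (d - c)) by lra.
  destruct (pow_lt_1_zero (1 / 2)) with (delta / (1 + (b - a) + (d - c))) as [N HN].
  { rewrite Rabs_pos_eq; lra. }
  { now apply Rdiv_lt_0_compat. }
  specialize (HN N (le_n N)). rewrite Rabs_pos_eq in HN by (left; apply Hpow).
  apply (Rmult_lt_compat_r (1 + (b - a) + (d - c))) in HN; [|assumption].
  unfold Rdiv at 2 in HN. rewrite (Rmult_assoc delta), Rinv_l, Rmult_1_r in HN by lra.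
  assert (Hs : (b - a) * (1 / 2) ^ N < delta /\ (d - c) * (1 / 2) ^ N < delta).
  { generalize (Hpow N). set (q := (1 / 2) ^ N) in *. clearbody q. split; nra. }
  destruct (Hin N) as (H1 & H2 & H3 & H4 & H5). apply H5.
  apply Hgood; try assumption; try apply Hx; try apply Hy; unfold w, h in *; lra.
Qed.

Lemma continuous_section (F : C -> C) (p q : R -> R) (t : R) :
  ex_derive F (p t, q t) -> continuous p t -> continuous q t ->
  continuous (fun s => fst (F (p s, q s))) t /\
  continuous (fun s => snd (F (p s, q s))) t.
Proof.
  intros HF Hp Hq.
  assert (Hc : continuous (fun s => F (p s, q s)) t).
  { apply (continuous_comp_2 p q (fun x y => F (x, y))); try assumption.
    simpl. apply continuous_ext with F; [now intros []|].
    now apply continuous_tends, ex_derive_tends. }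
  split.
  - apply (continuous_comp (fun s => F (p s, q s)) fst); [assumption|apply continuous_fst].
  - apply (continuous_comp (fun s => F (p s, q s)) snd); [assumption|apply continuous_snd].
Qed.

(** The real part of the integral of [F dz] round a rectangle.  Real parts
    suffice, since [F] may be multiplied by any complex constant. *)
Definition contour (F : C -> C) (a b c d : R) : R :=
  RInt (fun x => fst (F (x, c))) a b - RInt (fun x => fst (F (x, d))) a b
  - (RInt (fun y => snd (F (b, y))) c d - RInt (fun y => snd (F (a, y))) c d).

Lemma ex_RInt_section (F : C -> C) (a b c d : R) :
  (forall x y, a <= x <= b -> c <= y <= d -> ex_derive F (x, y)) ->
  (forall y p q, c <= y <= d -> a <= p -> p <= q -> q <= b ->
     ex_RInt (fun x => fst (F (x, y))) p q) /\
  (forall x p q, a <= x <= b -> c <= p -> p <= q -> q <= d ->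
     ex_RInt (fun y => snd (F (x, y))) p q).
Proof.
  intros HF. split; intros z p q Hz Hp Hpq Hq; apply (ex_RInt_continuous (V := R_CompleteNormedModule));
    rewrite Rmin_left, Rmax_right by assumption; intros t Ht.
  - refine (proj1 (continuous_section F (fun x => x) (fun _ => z) t _ _ _)).
    + apply HF; lra.
    + apply continuous_id.
    + apply continuous_const.
  - refine (proj2 (continuous_section F (fun _ => z) (fun y => y) t _ _ _)).
    + apply HF; lra.
    + apply continuous_const.
    + apply continuous_id.
Qed.

Lemma Rabs_fst_le_Cmod (z : C) : Rabs (fst z) <= Cmod z.
Proof. eapply Rle_trans; [apply Rmax_l|apply Rmax_Cmod]. Qed.

Lemma Rabs_snd_le_Cmod (z : C) : Rabs (snd z) <= Cmod z.
Proof. eapply Rle_trans; [apply Rmax_r|apply Rmax_Cmod]. Qed.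

Lemma Cmod_le_Rabs (x y : R) : Cmod (x, y) <= Rabs x + Rabs y.
Proof.
  replace (x, y) with (RtoC x + Ci * RtoC y)%C.
  - eapply Rle_trans; [apply Cmod_triangle|].
    rewrite Cmod_mult, Cmod_Ci, !Cmod_R. lra.
  - unfold RtoC, Ci, Cplus, Cmult; simpl. f_equal; ring.
Qed.

(** Near a point of differentiability, [F] is an affine function, whose contour
    integrals vanish, up to an error that is small compared with the size of the
    rectangle. *)
Lemma contour_small (F : C -> C) (a b c d : R) (l z0 : C) (eps : R) :
  a <= b -> c <= d -> 0 <= eps ->
  (forall x y, a <= x <= b -> c <= y <= d -> ex_derive F (x, y)) ->
  a <= fst z0 <= b -> c <= snd z0 <= d ->
  (forall z, a <= fst z <= b -> c <= snd z <= d ->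
     Cmod (F z - F z0 - l * (z - z0)) <= eps * Cmod (z - z0)) ->
  Rabs (contour F a b c d) <= 2 * eps * (b - a + (d - c)) ^ 2.
Proof.
  intros Hab Hcd He HF Hx0 Hy0 Hlin.
  destruct (ex_RInt_section F a b c d HF) as [Iu Iv].
  set (S := b - a + (d - c)).
  assert (Herr : forall x y, a <= x <= b -> c <= y <= d ->
    Cmod (F (x, y) - F z0 - l * ((x, y) - z0)) <= eps * S).
  { intros x y Hx Hy. eapply Rle_trans; [now apply Hlin|].
    apply Rmult_le_compat_l; [assumption|].
    eapply Rle_trans; [apply Cmod_le_Rabs|]. simpl. unfold S.
    apply Rplus_le_compat; apply Rabs_le; lra. }
  assert (Hu : forall x y, a <= x <= b -> c <= y <= d ->
    Rabs (fst (F (x, y)) - (fst (F z0) + (fst l * (x - fst z0) - snd l * (y - snd z0))))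
      <= eps * S).
  { intros x y Hx Hy. eapply Rle_trans; [|now apply (Herr x y)].
    eapply Rle_trans; [|apply Rabs_fst_le_Cmod]. right. f_equal. simpl. ring. }
  assert (Hv : forall x y, a <= x <= b -> c <= y <= d ->
    Rabs (snd (F (x, y)) - (snd (F z0) + (snd l * (x - fst z0) + fst l * (y - snd z0))))
      <= eps * S).
  { intros x y Hx Hy. eapply Rle_trans; [|now apply (Herr x y)].
    eapply Rle_trans; [|apply Rabs_snd_le_Cmod]. right. f_equal. simpl. ring. }
  assert (HS : 0 <= eps * S) by (apply Rmult_le_pos; [assumption|unfold S; lra]).
  assert (Hhor : Rabs (RInt (fun x => fst (F (x, c))) a b
      - RInt (fun x => fst (F (x, d))) a b - (b - a) * (snd l * (d - c)))
      <= (b - a) * (2 * (eps * S))).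
  { assert (Hi : is_RInt (fun x => fst (F (x, c)) - fst (F (x, d)) - snd l * (d - c)) a b
      (RInt (fun x => fst (F (x, c))) a b - RInt (fun x => fst (F (x, d))) a b
       - (b - a) * (snd l * (d - c)))).
    { apply (is_RInt_minus (V := R_NormedModule)).
      - apply (is_RInt_minus (V := R_NormedModule));
          apply (RInt_correct (V := R_CompleteNormedModule)); apply Iu; lra.
      - apply (is_RInt_const (V := R_NormedModule)). }
    apply (norm_RInt_le_const _ _ _ _ (2 * (eps * S)) Hab) in Hi; [exact Hi|].
    intros x Hx. change (Rabs (fst (F (x, c)) - fst (F (x, d)) - snd l * (d - c)) <= 2 * (eps * S)).
    assert (H1 := Hu x c Hx (conj (Rle_refl c) Hcd)).
    assert (H2 := Hu x d Hx (conj Hcd (Rle_refl d))).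
    apply Rabs_le_between in H1. apply Rabs_le_between in H2.
    apply Rabs_le. lra. }
  assert (Hver : Rabs (RInt (fun y => snd (F (b, y))) c d
      - RInt (fun y => snd (F (a, y))) c d - (d - c) * (snd l * (b - a)))
      <= (d - c) * (2 * (eps * S))).
  { assert (Hi : is_RInt (fun y => snd (F (b, y)) - snd (F (a, y)) - snd l * (b - a)) c d
      (RInt (fun y => snd (F (b, y))) c d - RInt (fun y => snd (F (a, y))) c d
       - (d - c) * (snd l * (b - a)))).
    { apply (is_RInt_minus (V := R_NormedModule)).
      - apply (is_RInt_minus (V := R_NormedModule));
          apply (RInt_correct (V := R_CompleteNormedModule)); apply Iv; lra.
      - apply (is_RInt_const (V := R_NormedModule)). }
    apply (norm_RInt_le_const _ _ _ _ (2 * (eps * S)) Hcd) in Hi; [exact Hi|].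
    intros y Hy. change (Rabs (snd (F (b, y)) - snd (F (a, y)) - snd l * (b - a)) <= 2 * (eps * S)).
    assert (H1 := Hv b y (conj Hab (Rle_refl b)) Hy).
    assert (H2 := Hv a y (conj (Rle_refl a) Hab) Hy).
    apply Rabs_le_between in H1. apply Rabs_le_between in H2.
    apply Rabs_le. lra. }
  unfold contour.
  apply Rabs_le_between in Hhor. apply Rabs_le_between in Hver.
  replace (2 * eps * S ^ 2)
    with ((b - a) * (2 * (eps * S)) + (d - c) * (2 * (eps * S))) by (unfold S; ring).
  apply Rabs_le. lra.
Qed.

(** The integrals along the two inner segments cancel. *)
Lemma contour_split (F : C -> C) (a b c d m n : R) :
  (forall x y, a <= x <= b -> c <= y <= d -> ex_derive F (x, y)) ->
  a <= m <= b -> c <= n <= d ->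
  contour F a b c d =
    contour F a m c n + contour F m b c n + contour F a m n d + contour F m b n d.
Proof.
  intros HF Hm Hn. destruct (ex_RInt_section F a b c d HF) as [Iu Iv].
  assert (Cu : forall y, c <= y <= d -> RInt (fun x => fst (F (x, y))) a b =
    RInt (fun x => fst (F (x, y))) a m + RInt (fun x => fst (F (x, y))) m b).
  { intros y Hy. symmetry. apply (RInt_Chasles (V := R_CompleteNormedModule)); apply Iu; lra. }
  assert (Cv : forall x, a <= x <= b -> RInt (fun y => snd (F (x, y))) c d =
    RInt (fun y => snd (F (x, y))) c n + RInt (fun y => snd (F (x, y))) n d).
  { intros x Hx. symmetry. apply (RInt_Chasles (V := R_CompleteNormedModule)); apply Iv; lra. }
  unfold contour. rewrite !Cu, !Cv by lra. ring.
Qed.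

(** The bound of [contour_small] is quadratic in the size, so it is additive under
    bisection and passes from small rectangles to the given one, for every
    [eps]. *)
Theorem goursat (F : C -> C) (a b c d : R) :
  a <= b -> c <= d ->
  (forall x y, a <= x <= b -> c <= y <= d -> ex_derive F (x, y)) ->
  contour F a b c d = 0.
Proof.
  intros Hab Hcd HF.
  assert (Hall : forall eps, 0 < eps ->
    Rabs (contour F a b c d) <= 2 * eps * (b - a + (d - c)) ^ 2).
  { intros eps He.
    apply (rectangle_induction
      (fun a b c d => Rabs (contour F a b c d) <= 2 * eps * (b - a + (d - c)) ^ 2));
      try assumption.
    - intros a' b' c' d' H1 H2 H3 H4 H5 H6 Q1 Q2 Q3 Q4.
      rewrite (contour_split F a' b' c' d' ((a' + b') / 2) ((c' + d') / 2)); try lra.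
      + eapply Rle_trans; [apply Rabs_triang|].
        eapply Rle_trans; [apply Rplus_le_compat_r, Rabs_triang|].
        eapply Rle_trans; [apply Rplus_le_compat_r, Rplus_le_compat_r, Rabs_triang|].
        lra.
      + intros x y Hx Hy. apply HF; lra.
    - intros x y Hx Hy. destruct (HF x y Hx Hy) as [l Hl].
      apply is_derive_tends in Hl. destruct (Hl eps He) as (delta & Hd & H).
      exists (delta / 2). split; [lra|].
      intros a' b' c' d' H1 H2 H3 H4 H5 H6 H7 H8.
      apply contour_small with l (x, y); try lra; simpl; try lra.
      + intros x' y' Hx' Hy'. apply HF; lra.
      + intros [x' y'] Hx' Hy'. simpl in Hx', Hy'.
        destruct (classic ((x', y') = (x, y))) as [->|Hne].
        * replace (F (x, y) - F (x, y) - l * ((x, y) - (x, y)))%C with (RtoC 0) by ring.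
          rewrite Cmod_0. apply Rmult_le_pos; [lra|apply Cmod_ge_0].
        * assert (Hlt : Cmod ((x', y') - (x, y)) < delta).
          { eapply Rle_lt_trans; [apply Cmod_le_Rabs|]. simpl.
            assert (Rabs (x' + - x) < delta / 2) by (apply Rabs_def1; lra).
            assert (Rabs (y' + - y) < delta / 2) by (apply Rabs_def1; lra). lra. }
          assert (Hz := Cminus_neq_0 _ _ Hne).
          replace (F (x', y') - F (x, y) - l * ((x', y') - (x, y)))%C
            with (((F (x', y') - F (x, y)) / ((x', y') - (x, y)) - l)
                  * ((x', y') - (x, y)))%C by (field; assumption).
          rewrite Cmod_mult. apply Rmult_le_compat_r; [apply Cmod_ge_0|].
          left. now apply H. }
  set (k := (b - a + (d - c)) ^ 2) in *. assert (Hk : 0 <= k) by apply pow2_ge_0.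
  apply cond_eq. intros e He. rewrite Rminus_0_r.
  eapply Rle_lt_trans; [apply (Hall (e / (4 * (1 + k))))|].
  - apply Rdiv_lt_0_compat; lra.
  - apply Rmult_lt_reg_r with (2 * (1 + k)); [lra|].
    replace (2 * (e / (4 * (1 + k))) * k * (2 * (1 + k))) with (e * k) by (field; lra).
    nra.
Qed.

(** * The maximum principle at the centre of a disc *)

Definition cexp (z : C) : C := (exp (fst z) * cos (snd z), exp (fst z) * sin (snd z)).

Lemma Cmod_cexp (z : C) : Cmod (cexp z) = exp (fst z).
Proof.
  unfold Cmod, cexp. simpl fst. simpl snd.
  replace ((exp (fst z) * cos (snd z)) ^ 2 + (exp (fst z) * sin (snd z)) ^ 2)
    with (exp (fst z) ^ 2).
  - apply sqrt_pow2. left. apply exp_pos.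
  - generalize (sin2_cos2 (snd z)). unfold Rsqr. intros E.
    replace (exp (fst z) ^ 2) with (exp (fst z) ^ 2 * 1) by ring. rewrite <- E. ring.
Qed.

Lemma cexp_plus (z w : C) : cexp (z + w) = (cexp z * cexp w)%C.
Proof.
  unfold cexp, Cplus, Cmult. simpl. rewrite exp_plus, cos_plus, sin_plus.
  f_equal; ring.
Qed.

(** The form of real differentiability at 0 that can be added and multiplied
    without dividing by [h]. *)
Lemma derivable_pt_lim_0 (f : R -> R) (l : R) :
  derivable_pt_lim f 0 l -> forall eps, 0 < eps -> exists delta, 0 < delta /\
    forall h, Rabs h < delta -> Rabs (f h - f 0 - l * h) <= eps * Rabs h.
Proof.
  intros H eps He. destruct (H eps He) as [delta Hd].
  exists delta. split; [apply cond_pos|]. intros h Hh.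
  destruct (Req_dec h 0) as [->|Hn].
  - replace (f 0 - f 0 - l * 0) with 0 by ring. rewrite Rabs_R0. lra.
  - specialize (Hd h Hn Hh). rewrite Rplus_0_l in Hd.
    replace (f h - f 0 - l * h) with (((f h - f 0) / h - l) * h) by (field; assumption).
    rewrite Rabs_mult. apply Rmult_le_compat_r; [apply Rabs_pos|lra].
Qed.

(** Up to terms of second order, [exp x cos y - 1] is [x] and [exp x sin y] is
    [y]. *)
Lemma cexp_near_0 : tends (fun w => (cexp w - RtoC 1) / w)%C (RtoC 0) (RtoC 1).
Proof.
  intros eps Heps. set (e := Rmin 1 (eps / 9)).
  assert (He : 0 < e) by (apply Rmin_pos; lra).
  assert (He1 : e <= 1) by apply Rmin_l. assert (He9 : e <= eps / 9) by apply Rmin_r.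
  clearbody e.
  destruct (derivable_pt_lim_0 exp 1 derivable_pt_lim_exp_0 e He) as (d1 & Hd1 & H1).
  destruct (derivable_pt_lim_0 cos 0 derivable_pt_lim_cos_0 e He) as (d2 & Hd2 & H2).
  destruct (derivable_pt_lim_0 sin 1 derivable_pt_lim_sin_0 e He) as (d3 & Hd3 & H3).
  rewrite exp_0 in H1. rewrite cos_0 in H2. rewrite sin_0 in H3.
  exists (Rmin e (Rmin d1 (Rmin d2 d3))). split.
  { repeat apply Rmin_pos; assumption. }
  intros w Hw Hlt. replace (w - RtoC 0)%C with w in Hlt by ring.
  replace ((cexp w - RtoC 1) / w - RtoC 1)%C
    with ((cexp w - RtoC 1 - w) / w)%C by (field; assumption).
  rewrite Cmod_div by assumption. apply Cmod_gt_0 in Hw. destruct w as [x y].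
  assert (Hx : Rabs x <= Cmod (x, y)) by apply (Rabs_fst_le_Cmod (x, y)).
  assert (Hy : Rabs y <= Cmod (x, y)) by apply (Rabs_snd_le_Cmod (x, y)).
  assert (L0 := Rmin_l e (Rmin d1 (Rmin d2 d3))).
  assert (L1 := Rmin_r e (Rmin d1 (Rmin d2 d3))).
  assert (L2 := Rmin_l d1 (Rmin d2 d3)). assert (L3 := Rmin_r d1 (Rmin d2 d3)).
  assert (L4 := Rmin_l d2 d3). assert (L5 := Rmin_r d2 d3).
  specialize (H1 x). specialize (H2 y). specialize (H3 y).
  assert (X := Rabs_pos x). assert (Y := Rabs_pos y).
  assert (A1 : Rabs (exp x - 1 - 1 * x) <= e * Rabs x) by (apply H1; lra).
  assert (A2 : Rabs (cos y - 1 - 0 * y) <= e * Rabs y) by (apply H2; lra).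
  assert (A3 : Rabs (sin y - 0 - 1 * y) <= e * Rabs y) by (apply H3; lra).
  clear H1 H2 H3.
  assert (Hre : Rabs (exp x * cos y - 1 - x) <= e * Rabs x + 2 * (e * Rabs y)).
  { replace (exp x * cos y - 1 - x)
      with ((exp x - 1 - 1 * x) * cos y + (1 + x) * (cos y - 1 - 0 * y)) by ring.
    eapply Rle_trans; [apply Rabs_triang|]. rewrite !Rabs_mult.
    apply Rplus_le_compat.
    - rewrite <- (Rmult_1_r (e * Rabs x)).
      apply Rmult_le_compat; try apply Rabs_pos; [assumption|].
      apply Rabs_le. apply COS_bound.
    - apply Rmult_le_compat; try apply Rabs_pos; [|assumption].
      eapply Rle_trans; [apply Rabs_triang|]. rewrite Rabs_R1. lra. }
  assert (Hex : Rabs (exp x - 1) <= 2 * e).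
  { replace (exp x - 1) with ((exp x - 1 - 1 * x) + x) by ring.
    eapply Rle_trans; [apply Rabs_triang|].
    assert (e * Rabs x <= 1 * Rabs x) by (apply Rmult_le_compat_r; lra). lra. }
  assert (Him : Rabs (exp x * sin y - y) <= 5 * (e * Rabs y)).
  { replace (exp x * sin y - y)
      with (exp x * (sin y - 0 - 1 * y) + (exp x - 1) * y) by ring.
    eapply Rle_trans; [apply Rabs_triang|]. rewrite !Rabs_mult.
    rewrite (Rabs_pos_eq (exp x)) by (left; apply exp_pos).
    assert (exp x <= 3).
    { apply Rle_trans with (exp 1); [|apply exp_le_3].
      destruct (Rle_lt_or_eq_dec x 1) as [Hl|Hl].
      - apply Rle_trans with (Rabs x); [apply Rle_abs|lra].
      - left; now apply exp_increasing.
      - rewrite Hl; lra. }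
    assert (exp x * Rabs (sin y - 0 - 1 * y) <= 3 * (e * Rabs y)).
    { apply Rmult_le_compat; [left; apply exp_pos|apply Rabs_pos|assumption|assumption]. }
    assert (Rabs (exp x - 1) * Rabs y <= 2 * e * Rabs y)
      by (apply Rmult_le_compat_r; assumption).
    lra. }
  apply Rmult_lt_reg_r with (Cmod (x, y)); [assumption|].
  unfold Rdiv. rewrite Rmult_assoc, Rinv_l, Rmult_1_r by lra.
  apply Rle_lt_trans with (8 * (e * Cmod (x, y))).
  - eapply Rle_trans.
    + replace (cexp (x, y) - RtoC 1 - (x, y))%C
        with ((exp x * cos y - 1 - x, exp x * sin y - y) : C).
      * apply Cmod_le_Rabs.
      * unfold cexp, RtoC, Cminus, Cplus, Copp. simpl. f_equal; ring.
    + assert (e * Rabs x <= e * Cmod (x, y)) by (apply Rmult_le_compat_l; lra).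
      assert (e * Rabs y <= e * Cmod (x, y)) by (apply Rmult_le_compat_l; lra). lra.
  - assert (e * Cmod (x, y) <= eps / 9 * Cmod (x, y)) by (apply Rmult_le_compat_r; lra).
    assert (0 < eps * Cmod (x, y)) by now apply Rmult_lt_0_compat. lra.
Qed.

Lemma is_C_derive_cexp (a : C) : is_derive cexp a (cexp a).
Proof.
  apply is_derive_tends. intros eps He.
  assert (Hp : 0 < Cmod (cexp a)) by (rewrite Cmod_cexp; apply exp_pos).
  destruct (cexp_near_0 (eps / Cmod (cexp a))) as (d & Hd & H).
  { now apply Rdiv_lt_0_compat. }
  exists d. split; [assumption|]. intros z Hz Hlt.
  assert (Hn := Cminus_neq_0 _ _ Hz).
  replace ((cexp z - cexp a) / (z - a) - cexp a)%C
    with (cexp a * ((cexp (z - a) - RtoC 1) / (z - a) - RtoC 1))%C.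
  - rewrite Cmod_mult. specialize (H (z - a)%C Hn).
    replace (z - a - RtoC 0)%C with (z - a)%C in H by ring. specialize (H Hlt).
    apply (Rmult_lt_compat_l (Cmod (cexp a))) in H; [|assumption].
    replace (Cmod (cexp a) * (eps / Cmod (cexp a))) with eps in H by (field; lra).
    assumption.
  - replace (cexp z) with (cexp a * cexp (z - a))%C.
    + field. assumption.
    + rewrite <- cexp_plus. f_equal. ring.
Qed.

(** The means of [G] over two concentric circles agree: in the coordinate
    [log z] the two circles become the vertical sides of a rectangle whose
    horizontal sides cancel by periodicity. *)
Lemma circle_mean_invariant (G : C -> C) (x1 x2 : R) :
  x1 <= x2 ->
  (forall z, 0 < Cmod z <= exp x2 -> ex_derive G z) ->
  RInt (fun y => fst (G (cexp (x1, y)))) 0 (2 * PI) =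
  RInt (fun y => fst (G (cexp (x2, y)))) 0 (2 * PI).
Proof.
  intros Hx HG. assert (HPI := PI_RGT_0).
  assert (E := goursat (fun z => Ci * G (cexp z))%C x1 x2 0 (2 * PI) Hx).
  unfold contour in E.
  rewrite (RInt_ext (fun x => fst (Ci * G (cexp (x, 0%R)))%C)
                    (fun x => fst (Ci * G (cexp (x, (2 * PI)%R)))%C)) in E.
  2:{ intros x _. unfold cexp. simpl fst. simpl snd.
      now rewrite cos_0, sin_0, cos_2PI, sin_2PI. }
  rewrite (RInt_ext (fun y => snd (Ci * G (cexp (x1, y)))%C)
                    (fun y => fst (G (cexp (x1, y))))) in E.
  2:{ intros y _. simpl. ring. }
  rewrite (RInt_ext (fun y => snd (Ci * G (cexp (x2, y)))%C)
                    (fun y => fst (G (cexp (x2, y))))) in E.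
  2:{ intros y _. simpl. ring. }
  enough (E' : forall u v w : R, u - u - (v - w) = 0 -> w = v)
    by (eapply E', E; [lra|]; intros x y Hx' Hy;
        apply ex_derive_mult_C; [apply ex_derive_const_C|];
        apply (ex_derive_comp_C G cexp); [|eexists; apply is_C_derive_cexp];
        apply HG; rewrite Cmod_cexp; simpl; split; [apply exp_pos|];
        destruct (Rle_lt_or_eq_dec x x2) as [Hl|Hl]; [lra| |];
        [left; now apply exp_increasing|rewrite Hl; lra]).
  intros; lra.
Qed.

Lemma exists_rotation (c : C) : exists u, Cmod u = 1 /\ (u * c)%C = RtoC (Cmod c).
Proof.
  destruct (classic (c = RtoC 0)) as [->|Hc].
  - exists (RtoC 1). split; [apply Cmod_1|]. rewrite Cmod_0. ring.
  - assert (Hm : 0 < Cmod c) by now apply Cmod_gt_0.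
    exists (RtoC (Cmod c) / c)%C. split.
    + rewrite Cmod_div, Cmod_R, Rabs_pos_eq by (assumption || lra). field. lra.
    + field. assumption.
Qed.

(** The mean of [G] over a small circle is close to [c], and it equals the mean
    over the circle of radius [r]. *)
Lemma centre_maximum_principle (G : C -> C) (c : C) (r M : R) :
  0 < r -> (forall z, 0 < Cmod z <= r -> ex_derive G z) ->
  tends G (RtoC 0) c -> (forall z, Cmod z = r -> Cmod (G z) <= M) ->
  Cmod c <= M.
Proof.
  intros Hr HG Hc HM. assert (HPI := PI_RGT_0).
  assert (HM0 : 0 <= M).
  { eapply Rle_trans; [apply Cmod_ge_0|]. apply (HM (RtoC r)).
    rewrite Cmod_R. apply Rabs_pos_eq. lra. }
  (* Rotate the values so that the limit becomes real and nonnegative. *)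
  destruct (exists_rotation c) as (u & Hu & Huc).
  apply le_epsilon. intros eps Heps.
  destruct (Hc eps Heps) as (d & Hd & Hnear).
  (* The circle of radius [rho] is so small that [G] is close to [c] on it. *)
  set (rho := Rmin r (d / 2)).
  assert (Hrho : 0 < rho) by (apply Rmin_pos; lra).
  assert (Hrr : rho <= r) by apply Rmin_l. assert (Hrd : rho <= d / 2) by apply Rmin_r.
  assert (Hln : ln rho <= ln r) by now apply ln_le.
  assert (Hd2 : forall z, 0 < Cmod z <= exp (ln r) -> ex_derive (fun z => u * G z)%C z).
  { intros z Hz. rewrite exp_ln in Hz by assumption.
    apply ex_derive_mult_C; [apply ex_derive_const_C|now apply HG]. }
  assert (E := circle_mean_invariant _ _ _ Hln Hd2).
  assert (Hint : forall x, x <= ln r ->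
    ex_RInt (fun y => fst (u * G (cexp (x, y)))%C) 0 (2 * PI)).
  { intros x Hx. apply (ex_RInt_continuous (V := R_CompleteNormedModule)).
    intros y _.
    refine (proj1 (continuous_section (fun z => u * G (cexp z))%C (fun _ => x) (fun y => y) y _ _ _)).
    - apply (ex_derive_comp_C (fun z => u * G z)%C cexp); [|eexists; apply is_C_derive_cexp].
      apply Hd2. rewrite Cmod_cexp. simpl. split; [apply exp_pos|].
      destruct (Rle_lt_or_eq_dec _ _ Hx) as [Hl|Hl];
        [left; now apply exp_increasing|rewrite Hl; lra].
    - apply continuous_const.
    - apply continuous_id. }
  assert (Hlow : 2 * PI * (Cmod c - eps) <=
    RInt (fun y => fst (u * G (cexp (ln rho, y)))%C) 0 (2 * PI)).
  { replace (2 * PI * (Cmod c - eps)) with (RInt (fun _ => Cmod c - eps) 0 (2 * PI)).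
    2:{ rewrite RInt_const. unfold scal. simpl. unfold mult. simpl. ring. }
    apply RInt_le; [lra|apply ex_RInt_const|now apply Hint|].
    intros y _. set (z := cexp (ln rho, y)).
    assert (Hz : Cmod z = rho) by (unfold z; rewrite Cmod_cexp; now apply exp_ln).
    assert (Hz0 : z <> 0) by (apply Cmod_gt_0; lra).
    assert (Hn : Cmod (u * (G z - c)) < eps).
    { rewrite Cmod_mult, Hu, Rmult_1_l. apply Hnear; [assumption|].
      replace (z - RtoC 0)%C with z by ring. lra. }
    assert (Hf := Rabs_fst_le_Cmod (u * (G z - c))%C).
    replace (u * (G z - c))%C with (u * G z - u * c)%C in * by ring.
    rewrite Huc in *. simpl in Hf. simpl fst.
    assert (Hf2 := Rle_lt_trans _ _ _ Hf Hn). apply Rabs_def2 in Hf2. simpl in *. lra. }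
  assert (Hup : RInt (fun y => fst (u * G (cexp (ln r, y)))%C) 0 (2 * PI) <= 2 * PI * M).
  { replace (2 * PI * M) with (RInt (fun _ => M) 0 (2 * PI)).
    2:{ rewrite RInt_const. unfold scal. simpl. unfold mult. simpl. ring. }
    apply RInt_le; [lra|now apply Hint, Rle_refl|apply ex_RInt_const|].
    intros y _. eapply Rle_trans; [apply Rle_abs|].
    eapply Rle_trans; [apply Rabs_fst_le_Cmod|].
    rewrite Cmod_mult, Hu, Rmult_1_l. apply HM. rewrite Cmod_cexp. now apply exp_ln. }
  rewrite <- E in Hup.
  assert (H := Rle_trans _ _ _ Hlow Hup).
  apply Rmult_le_reg_l in H; lra.
Qed.

(** * Lifting through a covering *)

(** The two properties of a covering that lifting uses.  The squaring map has them
    as well, which produces square roots. *)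
Definition locally_injective (f : C -> C) (A : C -> Prop) : Prop :=
  forall x, A x -> exists V : C -> Prop, open V /\ V x /\
    forall y z, V y -> V z -> f y = f z -> y = z.

Definition has_sections_over (f : C -> C) (A U : C -> Prop) : Prop :=
  forall x, A x -> U (f x) -> exists s : C -> C, s (f x) = x /\
    forall u, U u -> A (s u) /\ f (s u) = u /\ continuous s u.

Definition has_local_sections (f : C -> C) (A B : C -> Prop) : Prop :=
  forall w, B w -> exists U : C -> Prop, open U /\ U w /\
    has_sections_over f A U.

Definition is_lift (f : C -> C) (A : C -> Prop) (h : C -> C) (N : C -> Prop)
  (g : C -> C) : Prop :=
  forall z, N z -> A (g z) /\ f (g z) = h z /\ continuous g z.

Definition convex (N : C -> Prop) : Prop :=
  forall a b t, N a -> N b -> 0 <= t <= 1 -> N (a + RtoC t * (b - a))%C.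

Lemma covering_locally_injective (f : C -> C) (A B : C -> Prop) :
  covering_map f A B -> locally_injective f A.
Proof.
  intros (Hm & _ & Hc) x Hx.
  destruct (Hc (f x) (Hm x Hx)) as (U & _ & HUx & _ & I & sheet & Hop & _ & Heq & Hhom).
  destruct (proj1 (Heq x) (conj Hx HUx)) as [i Hi].
  destruct (Hhom i) as (_ & _ & g & _ & _ & Hg & _).
  exists (sheet i). repeat split; [apply Hop|assumption|].
  intros y z Hy Hz E. rewrite <- (Hg y Hy), <- (Hg z Hz). now f_equal.
Qed.

Lemma covering_has_local_sections (f : C -> C) (A B : C -> Prop) :
  covering_map f A B -> has_local_sections f A B.
Proof.
  intros (_ & _ & Hc) w Hw.
  destruct (Hc w Hw) as (U & HUo & HUw & _ & I & sheet & _ & _ & Heq & Hhom).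
  exists U. repeat split; try assumption. intros x Hx HUx.
  destruct (proj1 (Heq x) (conj Hx HUx)) as [i Hi].
  destruct (Hhom i) as (_ & _ & g & Hgm & Hgc & Hgf & Hfg).
  exists g. split; [now apply Hgf|]. intros u Hu.
  split; [|split; [now apply Hfg|now apply Hgc]].
  apply (Heq (g u)). exists i. now apply Hgm.
Qed.

(** The unit interval is connected. *)
Lemma interval_induction (P : R -> Prop) :
  (forall t, 0 <= t <= 1 -> exists delta, 0 < delta /\
     forall s, 0 <= s <= 1 -> Rabs (s - t) < delta -> (P s <-> P t)) ->
  P 0 -> P 1.
Proof.
  intros Hloc H0. apply NNPP. intros H1.
  set (clamp t := Rmax 0 (Rmin 1 t)).
  assert (Hcl : forall t, 0 <= clamp t <= 1).
  { intros t. unfold clamp. split; [apply Rmax_l|].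
    apply Rmax_lub; [lra|apply Rmin_l]. }
  assert (Hid : forall t, 0 <= t <= 1 -> clamp t = t).
  { intros t Ht. unfold clamp. rewrite Rmin_right, Rmax_right; lra. }
  assert (Hlip : forall s t, 0 <= t <= 1 -> Rabs (clamp s - t) <= Rabs (s - t)).
  { intros s t Ht. unfold clamp, Rmax, Rmin.
    repeat (destruct (Rle_dec _ _)); unfold Rabs;
      repeat (destruct (Rcase_abs _)); lra. }
  (* The indicator of [P] has derivative zero. *)
  set (phi t := if excluded_middle_informative (P (clamp t)) then 1 else 0).
  destruct (MVT_cor3 phi (fun _ => 0) 0 1 Rlt_0_1) as (x & _ & _ & E).
  - intros t Ht0 Ht1 eps He. destruct (Hloc t (conj Ht0 Ht1)) as (d & Hd & H).
    exists (mkposreal d Hd). intros k Hk Hlt. simpl in Hlt.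
    assert (Hs : P (clamp (t + k)) <-> P (clamp t)).
    { rewrite (Hid t) by lra. apply H; [apply Hcl|].
      eapply Rle_lt_trans; [apply Hlip; lra|].
      now replace (t + k - t) with k by ring. }
    replace (phi (t + k)) with (phi t).
    + replace ((phi t - phi t) / k - 0) with 0 by (field; assumption).
      now rewrite Rabs_R0.
    + unfold phi. do 2 destruct (excluded_middle_informative _); tauto.
  - unfold phi in E. rewrite !Hid in E by lra.
    do 2 destruct (excluded_middle_informative _); try tauto. lra.
Qed.

Lemma continuous_line (g : C -> C) (a v : C) (t eps : R) :
  continuous g (a + RtoC t * v)%C -> 0 < eps -> exists delta, 0 < delta /\
    forall s, Rabs (s - t) < delta ->
      Cmod (g (a + RtoC s * v) - g (a + RtoC t * v))%C < eps.
Proof.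
  intros Hg He. destruct (continuous_Cmod _ _ Hg eps He) as (d & Hd & H).
  assert (Hv := Cmod_ge_0 v).
  exists (d / (1 + Cmod v)). split; [apply Rdiv_lt_0_compat; lra|].
  intros s Hs. apply H.
  replace (a + RtoC s * v - (a + RtoC t * v))%C with (RtoC (s - t) * v)%C
    by (rewrite RtoC_minus; ring).
  rewrite Cmod_mult, Cmod_R.
  apply Rle_lt_trans with (Rabs (s - t) * (1 + Cmod v)).
  - apply Rmult_le_compat_l; [apply Rabs_pos|lra].
  - apply Rmult_lt_reg_r with (/ (1 + Cmod v)); [apply Rinv_0_lt_compat; lra|].
    rewrite Rmult_assoc, Rinv_r, Rmult_1_r by lra. exact Hs.
Qed.

(** Along a segment, the set where two lifts agree is open by local injectivity,
    and closed because the values are separated. *)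
Lemma lift_unique (f : C -> C) (A : C -> Prop) (h : C -> C) (N : C -> Prop)
  (g1 g2 : C -> C) (a p : C) :
  locally_injective f A -> convex N ->
  is_lift f A h N g1 -> is_lift f A h N g2 ->
  N a -> N p -> g1 a = g2 a -> g1 p = g2 p.
Proof.
  intros Hinj HN H1 H2 Ha Hp E0.
  set (gam t := (a + RtoC t * (p - a))%C).
  assert (Hgam : forall t, 0 <= t <= 1 -> N (gam t)) by (intros; now apply HN).
  replace p with (gam 1) by (unfold gam; ring).
  apply (interval_induction (fun t => g1 (gam t) = g2 (gam t))).
  2:{ replace (gam 0) with a by (unfold gam; ring). assumption. }
  intros t Ht. destruct (H1 _ (Hgam t Ht)) as (A1 & F1 & C1).
  destruct (H2 _ (Hgam t Ht)) as (A2 & F2 & C2).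
  destruct (classic (g1 (gam t) = g2 (gam t))) as [E|NE].
  - destruct (Hinj _ A1) as (V & HVo & HV & Hi).
    destruct (proj1 (open_Cmod V) HVo _ HV) as (e & He & HVe).
    destruct (continuous_line g1 a (p - a) t e C1 He) as (d1 & Hd1 & K1).
    destruct (continuous_line g2 a (p - a) t e C2 He) as (d2 & Hd2 & K2).
    exists (Rmin d1 d2). split; [now apply Rmin_pos|]. intros s Hs Hlt.
    split; intros _; [assumption|]. apply Hi.
    + apply HVe. apply K1. eapply Rlt_le_trans; [exact Hlt|apply Rmin_l].
    + apply HVe. rewrite E. apply K2. eapply Rlt_le_trans; [exact Hlt|apply Rmin_r].
    + destruct (H1 _ (Hgam s Hs)) as (_ & -> & _).
      now destruct (H2 _ (Hgam s Hs)) as (_ & -> & _).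
  - assert (Hp0 := proj1 (Cmod_gt_0 _) (Cminus_neq_0 _ _ NE)).
    set (e := Cmod (g1 (gam t) - g2 (gam t)) / 2) in *.
    assert (He : 0 < e) by (unfold e; lra).
    destruct (continuous_line g1 a (p - a) t e C1 He) as (d1 & Hd1 & K1).
    destruct (continuous_line g2 a (p - a) t e C2 He) as (d2 & Hd2 & K2).
    exists (Rmin d1 d2). split; [now apply Rmin_pos|]. intros s Hs Hlt.
    split; intros E; [exfalso|contradiction].
    specialize (K1 s (Rlt_le_trans _ _ _ Hlt (Rmin_l _ _))).
    specialize (K2 s (Rlt_le_trans _ _ _ Hlt (Rmin_r _ _))).
    fold (gam s) (gam t) in K1, K2.
    assert (T := Cmod_triangle (- (g1 (gam s) - g1 (gam t))) (g2 (gam s) - g2 (gam t))).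
    rewrite Cmod_opp in T.
    replace (- (g1 (gam s) - g1 (gam t)) + (g2 (gam s) - g2 (gam t)))%C
      with (g1 (gam t) - g2 (gam t))%C in T by (rewrite E; ring).
    unfold e in *. lra.
Qed.

Definition disc (a : C) (r : R) (z : C) : Prop := Cmod (z - a) < r.

(** A convex neighbourhood of the segment from 0 to [t p].  Measuring [tau] along
    [p] itself makes the tubes increase with [t]. *)
Definition tube (p : C) (t eps : R) (z : C) : Prop :=
  exists tau, 0 <= tau <= t /\ Cmod (z - RtoC tau * p) < eps.

Lemma disc_open (a : C) (r : R) : open (disc a r).
Proof.
  apply open_Cmod. intros z Hz. unfold disc in Hz.
  exists (r - Cmod (z - a)). split; [lra|]. intros y Hy. unfold disc.
  replace (y - a)%C with ((y - z) + (z - a))%C by ring.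
  eapply Rle_lt_trans; [apply Cmod_triangle|lra].
Qed.

Lemma Cmod_convex (x y : C) (t e : R) :
  Cmod x < e -> Cmod y < e -> 0 <= t <= 1 -> Cmod (x + RtoC t * (y - x)) < e.
Proof.
  intros Hx Hy Ht.
  replace (x + RtoC t * (y - x))%C with (RtoC (1 - t) * x + RtoC t * y)%C
    by (rewrite RtoC_minus; ring).
  eapply Rle_lt_trans; [apply Cmod_triangle|].
  rewrite !Cmod_mult, !Cmod_R, !Rabs_pos_eq by lra.
  destruct (Req_dec t 0) as [->|]; [lra|].
  assert (t * Cmod y < t * e) by (apply Rmult_lt_compat_l; lra).
  assert ((1 - t) * Cmod x <= (1 - t) * e) by (apply Rmult_le_compat_l; lra). lra.
Qed.

Lemma disc_convex (a : C) (r : R) : convex (disc a r).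
Proof.
  intros x y t Hx Hy Ht. unfold disc in *.
  replace (x + RtoC t * (y - x) - a)%C
    with ((x - a) + RtoC t * ((y - a) - (x - a)))%C by ring.
  now apply Cmod_convex.
Qed.

Lemma tube_open (p : C) (t e : R) : open (tube p t e).
Proof.
  apply open_Cmod. intros z (tau & Ht & Hz).
  destruct (proj1 (open_Cmod _) (disc_open (RtoC tau * p)%C e) z Hz) as (d & Hd & H).
  exists d. split; [assumption|]. intros y Hy. exists tau. split; [assumption|].
  now apply H.
Qed.

Lemma tube_convex (p : C) (t e : R) : convex (tube p t e).
Proof.
  intros x y s (tx & Htx & Hx) (ty & Hty & Hy) Hs.
  exists (tx + s * (ty - tx)). split; [split; nra|].
  replace (x + RtoC s * (y - x) - RtoC (tx + s * (ty - tx)) * p)%C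
    with ((x - RtoC tx * p) + RtoC s * ((y - RtoC ty * p) - (x - RtoC tx * p)))%C
    by (rewrite RtoC_plus, RtoC_mult, RtoC_minus; ring).
  now apply Cmod_convex.
Qed.

Lemma convex_inter (M N : C -> Prop) :
  convex M -> convex N -> convex (fun z => M z /\ N z).
Proof. intros HM HN a b t [] [] Ht. split; [now apply HM|now apply HN]. Qed.

Lemma continuous_ext_open (f g : C -> C) (N : C -> Prop) (a : C) :
  open N -> N a -> (forall z, N z -> f z = g z) -> continuous f a -> continuous g a.
Proof.
  intros HN Ha E H. apply continuous_tends. apply continuous_tends in H.
  rewrite <- E by assumption. revert H. apply tends_ext.
  destruct (proj1 (open_Cmod N) HN a Ha) as (d & Hd & HH).
  exists d. split; [assumption|]. intros z _ Hz. now apply E, HH.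
Qed.

(** The lift on the shorter tube and the section over the disc round [q] agree
    where tube and disc meet, because this intersection is convex; together they
    cover a thinner tube along the longer segment. *)
Lemma tube_lift_step (f : C -> C) (A : C -> Prop) (h : C -> C) (x0 p : C)
  (s t eps rho : R) (q : C) (U : C -> Prop) (g : C -> C) :
  locally_injective f A ->
  has_sections_over f A U ->
  (forall z, disc q rho z -> U (h z) /\ continuous h z) ->
  0 <= s -> 0 < eps -> 0 < rho ->
  (forall tau, s <= tau <= t -> disc q (rho / 2) (RtoC tau * p)%C) -> s <= t ->
  is_lift f A h (tube p s eps) g -> g (RtoC 0) = x0 ->
  exists eps' g', 0 < eps' /\ is_lift f A h (tube p t eps') g' /\ g' (RtoC 0) = x0.
Proof.
  intros Hinj Hsec HU Hs He Hrho Hseg Hst Hg Hg0.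
  assert (Hsp : tube p s eps (RtoC s * p)%C).
  { exists s. split; [lra|]. replace (RtoC s * p - RtoC s * p)%C with (RtoC 0) by ring.
    now rewrite Cmod_0. }
  assert (Hsq : disc q rho (RtoC s * p)%C).
  { specialize (Hseg s). unfold disc in *. lra. }
  destruct (Hg _ Hsp) as (A1 & F1 & _).
  destruct (Hsec _ A1) as (sec & Hsec0 & Hsecu).
  { rewrite F1. now apply HU. }
  assert (Hlift2 : is_lift f A h (disc q rho) (fun z => sec (h z))).
  { intros z Hz. destruct (HU z Hz) as [Hz1 Hz2].
    destruct (Hsecu _ Hz1) as (S1 & S2 & S3). repeat split; try assumption.
    now apply (continuous_comp h sec). }
  set (g' z := if excluded_middle_informative (tube p s eps z) then g z else sec (h z)).
  assert (E1 : forall z, tube p s eps z -> g z = g' z).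
  { intros z Hz. unfold g'. now destruct (excluded_middle_informative _). }
  assert (E2 : forall z, disc q rho z -> sec (h z) = g' z).
  { intros z Hz. unfold g'. destruct (excluded_middle_informative _) as [Ht|]; [|reflexivity].
    symmetry.
    apply (lift_unique f A h (fun z => tube p s eps z /\ disc q rho z) g
             (fun z => sec (h z)) (RtoC s * p)%C z); try (now split); try assumption.
    - apply convex_inter; [apply tube_convex|apply disc_convex].
    - intros y [Hy _]. now apply Hg.
    - intros y [_ Hy]. now apply Hlift2.
    - now rewrite <- F1, Hsec0. }
  exists (Rmin eps (rho / 2)), g'.
  assert (L1 := Rmin_l eps (rho / 2)). assert (L2 := Rmin_r eps (rho / 2)).
  split; [apply Rmin_pos; lra|]. split.
  - intros z (tau & Htau & Hz).
    destruct (Rle_lt_dec tau s) as [Hle|Hlt].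
    + assert (Hin : tube p s eps z) by (exists tau; split; lra).
      rewrite <- E1 by assumption. destruct (Hg _ Hin) as (G1 & G2 & G3).
      repeat split; try assumption.
      apply (continuous_ext_open g g' _ z (tube_open p s eps) Hin E1 G3).
    + assert (Hin : disc q rho z).
      { unfold disc in *. specialize (Hseg tau).
        replace (z - q)%C with ((z - RtoC tau * p) + (RtoC tau * p - q))%C by ring.
        eapply Rle_lt_trans; [apply Cmod_triangle|]. lra. }
      rewrite <- E2 by assumption. destruct (Hlift2 _ Hin) as (G1 & G2 & G3).
      repeat split; try assumption.
      apply (continuous_ext_open (fun z => sec (h z)) g' _ z (disc_open q rho) Hin E2 G3).
  - rewrite <- E1; [assumption|]. exists 0. split; [lra|].
    replace (RtoC 0 - RtoC 0 * p)%C with (RtoC 0) by ring. now rewrite Cmod_0.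
Qed.

(** Lifts exist along every segment from the origin: the set of the parameters up
    to which a lift exists is open and closed in the unit interval. *)
Lemma tube_lift (f : C -> C) (A B : C -> Prop) (h : C -> C) (x0 p : C) :
  locally_injective f A -> has_local_sections f A B ->
  (forall z, unit_disc z -> B (h z) /\ continuous h z) ->
  A x0 -> f x0 = h (RtoC 0) -> unit_disc p ->
  exists eps g, 0 < eps /\ is_lift f A h (tube p 1 eps) g /\ g (RtoC 0) = x0.
Proof.
  intros Hinj Hsec Hh Hx0 E0 Hp. unfold unit_disc in *.
  assert (Hp0 := Cmod_ge_0 p).
  assert (Hnear : forall q, Cmod q < 1 -> exists rho U, 0 < rho /\
    has_sections_over f A U /\
    (forall z, disc q rho z -> U (h z) /\ continuous h z)).
  { intros q Hq. destruct (Hh q Hq) as [HB Hc].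
    destruct (Hsec _ HB) as (U & HUo & HUq & HU).
    destruct (proj1 (open_Cmod U) HUo _ HUq) as (e & He & HUe).
    destruct (continuous_Cmod _ _ Hc e He) as (d & Hd & Hhd).
    exists (Rmin d (1 - Cmod q)), U. split; [apply Rmin_pos; lra|]. split; [assumption|].
    intros z Hz. unfold disc in Hz.
    assert (L1 := Rmin_l d (1 - Cmod q)). assert (L2 := Rmin_r d (1 - Cmod q)).
    split; [apply HUe, Hhd; lra|]. apply Hh.
    replace z with ((z - q) + q)%C by ring.
    eapply Rle_lt_trans; [apply Cmod_triangle|lra]. }
  apply (interval_induction (fun t => exists eps g, 0 < eps /\
    is_lift f A h (tube p t eps) g /\ g (RtoC 0) = x0)).
  - intros t Ht. destruct (Hnear (RtoC t * p)%C) as (rho & U & Hrho & HU & HhU).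
    { rewrite Cmod_mult, Cmod_R, Rabs_pos_eq by lra. nra. }
    exists (rho / 2). split; [lra|].
    assert (Hclose : forall tau, Rabs (tau - t) < rho / 2 ->
      disc (RtoC t * p)%C (rho / 2) (RtoC tau * p)%C).
    { intros tau Htau. unfold disc.
      replace (RtoC tau * p - RtoC t * p)%C with (RtoC (tau - t) * p)%C
        by (rewrite RtoC_minus; ring).
      rewrite Cmod_mult, Cmod_R. generalize (Rabs_pos (tau - t)). nra. }
    assert (Hstep : forall s s', 0 <= s -> Rabs (s - t) < rho / 2 ->
      Rabs (s' - t) < rho / 2 ->
      (exists eps g, 0 < eps /\ is_lift f A h (tube p s eps) g /\ g (RtoC 0) = x0) ->
      (exists eps g, 0 < eps /\ is_lift f A h (tube p s' eps) g /\ g (RtoC 0) = x0)).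
    { intros s s' Hs Hst Hst' (eps & g & He & Hg & Hg0).
      destruct (Rle_lt_dec s s') as [Hle|Hlt].
      - apply (tube_lift_step f A h x0 p s s' eps rho (RtoC t * p)%C U g); try assumption.
        intros tau Htau. apply Hclose. apply Rabs_def2 in Hst. apply Rabs_def2 in Hst'.
        apply Rabs_def1; lra.
      - exists eps, g. split; [assumption|]. split; [|assumption].
        intros z (tau & Htau & Hz). apply Hg. exists tau. split; [lra|assumption]. }
    assert (Ht0 : Rabs (t - t) < rho / 2) by (rewrite Rminus_diag, Rabs_R0; lra).
    intros s Hs Hlt. split; apply Hstep; try assumption; lra.
  - destruct (Hnear (RtoC 0)) as (rho & U & Hrho & HU & HhU).
    { rewrite Cmod_0. lra. }
    assert (H00 : disc (RtoC 0) rho (RtoC 0)).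
    { unfold disc. replace (RtoC 0 - RtoC 0)%C with (RtoC 0) by ring. now rewrite Cmod_0. }
    destruct (HU x0 Hx0) as (sec & Hsec0 & Hsecu).
    { rewrite E0. now apply HhU. }
    exists rho, (fun z => sec (h z)). split; [assumption|]. split.
    + intros z (tau & Htau & Hz).
      assert (Hin : disc (RtoC 0) rho z).
      { unfold disc. replace tau with 0 in Hz by lra.
        now replace (z - RtoC 0)%C with (z - RtoC 0 * p)%C by ring. }
      destruct (HhU z Hin) as [Hz1 Hz2].
      destruct (Hsecu _ Hz1) as (S1 & S2 & S3). repeat split; try assumption.
      now apply (continuous_comp h sec).
    + rewrite <- E0. exact Hsec0.
Qed.

(** The disc is covered by tubes round the segments from the origin, and the lifts
    along these agree since two such tubes have a convex intersection that
    contains the origin. *)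
Theorem disc_lift (f : C -> C) (A B : C -> Prop) (h : C -> C) (x0 : C) :
  locally_injective f A -> has_local_sections f A B ->
  (forall z, unit_disc z -> B (h z) /\ continuous h z) ->
  A x0 -> f x0 = h (RtoC 0) ->
  exists g, is_lift f A h unit_disc g /\ g (RtoC 0) = x0.
Proof.
  intros Hinj Hsec Hh Hx0 E0.
  set (value p y := exists eps g, 0 < eps /\ is_lift f A h (tube p 1 eps) g /\
                      g (RtoC 0) = x0 /\ y = g p).
  set (G p := epsilon (inhabits (RtoC 0)) (value p)).
  assert (H0 : forall p eps, 0 < eps -> tube p 1 eps (RtoC 0)).
  { intros p eps He. exists 0. split; [lra|].
    replace (RtoC 0 - RtoC 0 * p)%C with (RtoC 0) by ring. now rewrite Cmod_0. }
  assert (H1 : forall p eps, 0 < eps -> tube p 1 eps p).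
  { intros p eps He. exists 1. split; [lra|].
    replace (p - RtoC 1 * p)%C with (RtoC 0) by ring. now rewrite Cmod_0. }
  assert (HG : forall p, unit_disc p -> value p (G p)).
  { intros p Hp. apply epsilon_spec.
    destruct (tube_lift f A B h x0 p) as (eps & g & He & Hg & Hg0); try assumption.
    exists (g p), eps, g. auto. }
  (* The lifts along two tubes agree where the tubes meet. *)
  assert (Hagree : forall p eps g, 0 < eps -> is_lift f A h (tube p 1 eps) g ->
    g (RtoC 0) = x0 -> forall z, unit_disc z -> tube p 1 eps z -> g z = G z).
  { intros p eps g He Hg Hg0 z Hz Hpz.
    destruct (HG z Hz) as (eps' & g' & He' & Hg' & Hg0' & ->).
    apply (lift_unique f A h (fun y => tube p 1 eps y /\ tube z 1 eps' y) g g' (RtoC 0) z);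
      try assumption; try (split; auto; fail).
    - apply convex_inter; apply tube_convex.
    - intros y [Hy _]. now apply Hg.
    - intros y [_ Hy]. now apply Hg'.
    - now rewrite Hg0, Hg0'. }
  exists G. split.
  - intros p Hp.
    destruct (tube_lift f A B h x0 p) as (eps & g & He & Hg & Hg0); try assumption.
    destruct (Hg p (H1 p eps He)) as (G1 & G2 & G3).
    rewrite <- (Hagree p eps g) by auto. repeat split; try assumption.
    apply (continuous_ext_open g G (fun z => tube p 1 eps z /\ disc (RtoC 0) 1 z)).
    + apply open_and; [apply tube_open|apply disc_open].
    + split; [now apply H1|]. unfold disc. now replace (p - RtoC 0)%C with p by ring.
    + intros z [Hz1 Hz2]. apply (Hagree p eps g); try assumption.
      unfold disc in Hz2. now replace (z - RtoC 0)%C with z in Hz2 by ring.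
    + assumption.
  - assert (Hd0 : unit_disc (RtoC 0)) by (unfold unit_disc; rewrite Cmod_0; lra).
    destruct (HG _ Hd0) as (eps & g & _ & _ & Hg0 & ->). assumption.
Qed.

(** * Consequences of the maximum principle *)

Lemma tends_shift (Q : C -> C) (a l : C) :
  tends Q a l -> tends (fun z => Q (a + z)%C) (RtoC 0) l.
Proof.
  intros H eps He. destruct (H eps He) as (d & Hd & HH).
  exists d. split; [assumption|]. intros z Hz Hlt. apply HH.
  - intros E. apply Hz. replace z with (a + z - a)%C by ring. rewrite E. ring.
  - replace (z - RtoC 0)%C with z in Hlt by ring. now replace (a + z - a)%C with z by ring.
Qed.

Lemma ex_derive_shift (F : C -> C) (a z : C) :
  ex_derive F (a + z)%C -> ex_derive (fun y => F (a + y)%C) z.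
Proof.
  intros H. apply (ex_derive_comp_C F (fun y => a + y)%C); [assumption|].
  apply ex_derive_plus_C; [apply ex_derive_const_C|apply ex_derive_id_C].
Qed.

Lemma tends_quotient_shift (F : C -> C) (a l : C) :
  is_derive F a l -> tends (fun z => (F (a + z) - F a) / z)%C (RtoC 0) l.
Proof.
  intros H. apply is_derive_tends in H. apply tends_shift in H.
  revert H. apply tends_ext_all. intros z _. f_equal. f_equal. ring.
Qed.

(** The maximum principle for the difference quotient of [F] at [a]. *)
Lemma cauchy_estimate (F : C -> C) (a l : C) (r M : R) :
  0 < r -> (forall z, Cmod (z - a) <= r -> ex_derive F z) -> is_derive F a l ->
  (forall z, Cmod (z - a) = r -> Cmod (F z - F a) <= M) -> Cmod l <= M / r.
Proof.
  intros Hr HF Hl HM.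
  assert (Ha : forall z, (a + z - a)%C = z) by (intros; ring).
  apply (centre_maximum_principle (fun z => (F (a + z) - F a) / z)%C l r); try assumption.
  - intros z Hz. apply ex_derive_div_C.
    + apply ex_derive_minus_C; [|apply ex_derive_const_C].
      apply ex_derive_shift, HF. rewrite Ha. lra.
    + apply ex_derive_id_C.
    + now apply Cmod_gt_0.
  - now apply tends_quotient_shift.
  - intros z Hz. rewrite Cmod_div by (apply Cmod_gt_0; lra). rewrite Hz.
    apply Rmult_le_compat_r; [left; now apply Rinv_0_lt_compat|].
    apply HM. now rewrite Ha.
Qed.

Lemma derivable_along_line (F : C -> C) (a v l : C) (t : R) :
  is_derive F (a + RtoC t * v)%C l ->
  derivable_pt_lim (fun s => fst (F (a + RtoC s * v)%C)) t (fst (l * v)%C).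
Proof.
  intros H. assert (Hv := Cmod_ge_0 v). apply is_derive_tends in H. intros eps He.
  destruct (H (eps / (1 + Cmod v))) as (d & Hd & HH).
  { apply Rdiv_lt_0_compat; lra. }
  assert (Hd' : 0 < d / (1 + Cmod v)) by (apply Rdiv_lt_0_compat; lra).
  exists (mkposreal _ Hd'). intros k Hk Hlt. simpl in Hlt.
  set (z0 := (a + RtoC t * v)%C) in *. set (z := (a + RtoC (t + k) * v)%C).
  assert (Hz : (z - z0)%C = (RtoC k * v)%C)
    by (unfold z, z0; rewrite RtoC_plus; ring).
  replace ((fst (F z) - fst (F z0)) / k - fst (l * v)%C)
    with (fst ((F z - F z0) * RtoC (/ k) - l * v)%C)
    by (simpl; field; assumption).
  eapply Rle_lt_trans; [apply Rabs_fst_le_Cmod|].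
  destruct (classic (v = RtoC 0)) as [->|Hv0].
  { replace z with z0 by (unfold z, z0; ring).
    replace ((F z0 - F z0) * RtoC (/ k) - l * RtoC 0)%C with (RtoC 0) by ring.
    now rewrite Cmod_0. }
  assert (Hk0 : RtoC k <> RtoC 0) by (intros E; apply Hk; now injection E).
  assert (Hkv : (RtoC k * v)%C <> RtoC 0) by now apply Cmult_neq_0.
  replace ((F z - F z0) * RtoC (/ k) - l * v)%C
    with (((F z - F z0) / (z - z0) - l) * v)%C
    by (rewrite Hz, RtoC_inv by assumption; field; now split).
  assert (Hvp : 0 < Cmod v) by now apply Cmod_gt_0.
  rewrite Cmod_mult.
  apply Rlt_le_trans with (eps / (1 + Cmod v) * Cmod v).
  - apply Rmult_lt_compat_r; [assumption|]. apply HH.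
    + intros E. apply Hkv. rewrite <- Hz, E. ring.
    + rewrite Hz, Cmod_mult, Cmod_R.
      apply Rlt_le_trans with (d / (1 + Cmod v) * Cmod v).
      * now apply Rmult_lt_compat_r.
      * apply Rmult_le_reg_r with (1 + Cmod v); [lra|].
        replace (d / (1 + Cmod v) * Cmod v * (1 + Cmod v)) with (d * Cmod v)
          by (field; lra). nra.
  - apply Rmult_le_reg_r with (1 + Cmod v); [lra|].
    replace (eps / (1 + Cmod v) * Cmod v * (1 + Cmod v)) with (eps * Cmod v)
      by (field; lra). nra.
Qed.

(** The real mean value theorem along the segment, for the real part of [F] after
    a rotation that makes [F q - F p] real. *)
Lemma mean_value_inequality (F : C -> C) (N : C -> Prop) (L : R) (p q : C) :
  convex N -> (forall z, N z -> exists l, is_derive F z l /\ Cmod l <= L) ->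
  N p -> N q -> Cmod (F q - F p) <= L * Cmod (q - p).
Proof.
  intros HN HF Hp Hq.
  destruct (exists_rotation (F q - F p)%C) as (u & Hu & Huc).
  assert (HD : forall t, exists d, 0 <= t <= 1 ->
    derivable_pt_lim (fun s => fst (u * F (p + RtoC s * (q - p)))%C) t d /\
    d <= L * Cmod (q - p)).
  { intros t. destruct (classic (0 <= t <= 1)) as [Ht|]; [|exists 0; tauto].
    destruct (HF _ (HN p q t Hp Hq Ht)) as (l & Hl & Hle).
    exists (fst (u * l * (q - p))%C). intros _. split.
    - apply (derivable_along_line (fun z => u * F z)%C).
      replace (u * l)%C with (RtoC 0 * F (p + RtoC t * (q - p)) + u * l)%C by ring.
      now apply (is_C_derive_mult (fun _ => u) F); [apply is_C_derive_const|].
    - eapply Rle_trans; [apply Rle_abs|]. eapply Rle_trans; [apply Rabs_fst_le_Cmod|].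
      rewrite !Cmod_mult, Hu, Rmult_1_l. apply Rmult_le_compat_r; [apply Cmod_ge_0|assumption]. }
  destruct (choice _ HD) as [df Hdf].
  destruct (MVT_cor3 _ df 0 1 Rlt_0_1 (fun x H1 H2 => proj1 (Hdf x (conj H1 H2))))
    as (x & Hx0 & Hx1 & E).
  assert (Hx := proj2 (Hdf x (conj Hx0 Hx1))).
  replace (p + RtoC 1 * (q - p))%C with q in E by ring.
  replace (p + RtoC 0 * (q - p))%C with p in E by ring.
  replace (Cmod (F q - F p)) with (fst (u * (F q - F p))%C) by now rewrite Huc.
  replace (u * (F q - F p))%C with (u * F q - u * F p)%C by ring.
  change (fst (u * F q)%C + - fst (u * F p)%C <= L * Cmod (q - p)). lra.
Qed.

(** The last hypothesis on [f] says that its inverse is continuous at [f x], so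
    that [f z] stays away from [f zeta] for [z] on a fixed small circle round any
    [zeta] close to [x].  By the maximum principle for the reciprocal of the
    difference quotient, [f' zeta] is then zero or bounded below.  As [f'] is
    continuous, it would vanish identically near a zero, against injectivity. *)
Lemma injective_derivative_neq_0 (f : C -> C) (x l : C) (rad : R) :
  0 < rad -> (forall z, disc x rad z -> ex_derive f z) ->
  (forall y z, disc x rad y -> disc x rad z -> f y = f z -> y = z) ->
  (forall rho, 0 < rho -> exists m, 0 < m /\
     forall z, disc x rad z -> Cmod (f z - f x) < m -> Cmod (z - x) < rho) ->
  is_derive f x l -> l <> RtoC 0.
Proof.
  intros HR Hhol Hinj Hinv Hl ->. unfold disc in *.
  set (rho := rad / 4). assert (Hrho : 0 < rho) by (unfold rho; lra).
  destruct (Hinv (rho / 2)) as (m & Hm & Hmz); [lra|].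
  assert (Hx0 : Cmod (x - x) < rad).
  { replace (x - x)%C with (RtoC 0) by ring. now rewrite Cmod_0. }
  assert (Hc : continuous f x) by now apply continuous_tends, ex_derive_tends, Hhol.
  assert (Htri : forall u v w : C, Cmod (u - w) <= Cmod (u - v) + Cmod (v - w)).
  { intros u v w. replace (u - w)%C with ((u - v) + (v - w))%C by ring.
    apply Cmod_triangle. }
  assert (Hsym : forall u v : C, Cmod (u - v) = Cmod (v - u)).
  { intros u v. rewrite <- Cmod_opp. f_equal. ring. }
  destruct (continuous_Cmod f x Hc (m / 2)) as (d1 & Hd1 & Hf1); [lra|].
  assert (Hlow : forall zeta k, Cmod (zeta - x) < d1 -> Cmod (zeta - x) < rho / 2 ->
    is_derive f zeta k -> k <> RtoC 0 -> m / (2 * rho) <= Cmod k).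
  { intros zeta k Hz1 Hz2 Hk Hk0.
    assert (Hdisc : forall z, Cmod z <= rho -> Cmod (zeta + z - x) < rad).
    { intros z Hz. replace (zeta + z - x)%C with (z + (zeta - x))%C by ring.
      eapply Rle_lt_trans; [apply Cmod_triangle|]. unfold rho in *. lra. }
    assert (Hne : forall z, 0 < Cmod z <= rho -> (f (zeta + z) - f zeta)%C <> RtoC 0).
    { intros z Hz E. assert (Hz0 : z <> RtoC 0) by now apply Cmod_gt_0.
      apply Hz0. replace z with (zeta + z - zeta)%C by ring.
      rewrite (Hinj (zeta + z)%C zeta); [ring|now apply Hdisc| |].
      - unfold rho in *. lra.
      - replace (f (zeta + z)%C) with (f (zeta + z)%C - f zeta + f zeta)%C by ring.
        rewrite E. ring. }
    assert (Hmax : Cmod (/ k) <= rho / (m / 2)).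
    { apply (centre_maximum_principle (fun z => z / (f (zeta + z) - f zeta))%C (/ k)%C rho);
        try assumption.
      - intros z Hz. apply ex_derive_div_C; [apply ex_derive_id_C| |now apply Hne].
        apply ex_derive_minus_C; [|apply ex_derive_const_C].
        now apply ex_derive_shift, Hhol, Hdisc.
      - apply tends_ext with (fun z => / ((f (zeta + z) - f zeta) / z))%C.
        + exists rho. split; [assumption|]. intros z Hz Hlt.
          replace (z - RtoC 0)%C with z in Hlt by ring. field.
          split; [|assumption]. apply Hne. split; [now apply Cmod_gt_0|lra].
        + apply tends_inv; [now apply tends_quotient_shift|assumption].
      - intros z Hz. rewrite Cmod_div by (apply Hne; lra). rewrite Hz.
        apply Rmult_le_compat_l; [lra|]. apply Rinv_le_contravar; [lra|].
        apply Rnot_lt_le. intros Hlt.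
        assert (Hmx : Cmod (zeta + z - x) < rho / 2).
        { apply Hmz; [apply Hdisc; lra|].
          generalize (Htri (f (zeta + z)%C) (f zeta) (f x)) (Hf1 zeta Hz1). lra. }
        generalize (Cmod_triangle (zeta + z - x) (x - zeta)).
        replace (zeta + z - x + (x - zeta))%C with z by ring.
        rewrite (Hsym x zeta). lra. }
    rewrite Cmod_inv in Hmax by assumption.
    assert (Hkp : 0 < Cmod k) by now apply Cmod_gt_0.
    apply Rmult_le_reg_r with (/ Cmod k * (2 * rho / m)).
    - apply Rmult_lt_0_compat; [now apply Rinv_0_lt_compat|].
      apply Rdiv_lt_0_compat; lra.
    - replace (m / (2 * rho) * (/ Cmod k * (2 * rho / m))) with (/ Cmod k) by (field; lra).
      replace (Cmod k * (/ Cmod k * (2 * rho / m))) with (rho / (m / 2)) by (field; lra).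
      assumption. }
  (* [f] is bounded, hence Lipschitz, hence [f'] is Lipschitz at [x]. *)
  destruct (continuous_Cmod f x Hc 1) as (d2 & Hd2 & Hf2); [lra|].
  set (d := Rmin d2 rad). assert (Hd : 0 < d) by (apply Rmin_pos; lra).
  assert (Hdd : d <= d2) by apply Rmin_l. assert (HdR : d <= rad) by apply Rmin_r.
  clearbody d.
  set (L := 2 / (d / 4)).
  assert (HL : 0 < L) by (unfold L; apply Rdiv_lt_0_compat; lra).
  assert (Hlip : forall z, disc x (d / 2) z -> exists k, is_derive f z k /\ Cmod k <= L).
  { intros z Hz. unfold disc in Hz. destruct (Hhol z) as [k Hk]; [lra|].
    exists k. split; [assumption|].
    apply (cauchy_estimate f z k (d / 4) 2); try assumption; [lra| |].
    - intros y Hy. apply Hhol. generalize (Htri y z x). lra.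
    - intros y Hy.
      assert (Hy2 : Cmod (y - x) < d2) by (generalize (Htri y z x); lra).
      assert (Hz2 : Cmod (z - x) < d2) by lra.
      generalize (Htri (f y) (f x) (f z)) (Hf2 y Hy2) (Hf2 z Hz2).
      rewrite (Hsym (f x) (f z)). lra. }
  assert (Hcont : forall zeta k, Cmod (zeta - x) < d / 8 -> is_derive f zeta k ->
    Cmod k <= 2 * L * Cmod (zeta - x) / (d / 8)).
  { intros zeta k Hz Hk.
    assert (Hin : forall z, Cmod (z - x) <= d / 8 ->
      Cmod (f (zeta - x + z)%C - f z) <= L * Cmod (zeta - x)).
    { intros z Hzx. replace (zeta - x)%C with (zeta - x + z - z)%C at 2 by ring.
      apply (mean_value_inequality f (disc x (d / 2))); [apply disc_convex|assumption| |];
        unfold disc; [lra|].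
      replace (zeta - x + z - x)%C with ((zeta - x) + (z - x))%C by ring.
      eapply Rle_lt_trans; [apply Cmod_triangle|lra]. }
    apply (cauchy_estimate (fun z => f (zeta - x + z) - f z)%C x k (d / 8)); [lra| | |].
    - intros z Hzx. apply ex_derive_minus_C.
      + apply ex_derive_shift, Hhol.
        replace (zeta - x + z - x)%C with ((zeta - x) + (z - x))%C by ring.
        eapply Rle_lt_trans; [apply Cmod_triangle|lra].
      + apply Hhol. lra.
    - apply is_derive_ext_near with (fun z => f (zeta - x + z) + - RtoC 1 * f z)%C.
      { exists 1. split; [lra|]. intros. ring. }
      replace k with (k * (RtoC 0 + RtoC 1) + (RtoC 0 * f x + - RtoC 1 * RtoC 0))%C by ring.
      apply is_C_derive_plus.
      + apply (is_C_derive_comp f (fun z => zeta - x + z)%C).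
        * now replace (zeta - x + x)%C with zeta by ring.
        * apply is_C_derive_plus; [apply is_C_derive_const|apply is_C_derive_id].
      + now apply (is_C_derive_mult (fun _ => - RtoC 1)%C); [apply is_C_derive_const|].
    - intros z Hzx.
      generalize (Cmod_triangle (f (zeta - x + z)%C - f z) (- (f (zeta - x + x)%C - f x))).
      rewrite Cmod_opp.
      assert (H1 := Hin z). assert (H2 := Hin x).
      replace (x - x)%C with (RtoC 0) in H2 by ring. rewrite Cmod_0 in H2.
      specialize (H1 (Req_le _ _ Hzx)). specialize (H2 ltac:(lra)).
      intros T. eapply Rle_trans; [exact T|lra]. }
  (* Within [c] of [x] the Lipschitz bound on [f'] is below the lower bound [Hlow]. *)
  set (c := m / (2 * rho) / (16 * L / d)).
  assert (HLd : 0 < 16 * L / d) by (apply Rdiv_lt_0_compat; lra).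
  assert (Hmr : 0 < m / (2 * rho)) by (apply Rdiv_lt_0_compat; lra).
  assert (Hc0 : 0 < c) by (unfold c; now apply Rdiv_lt_0_compat).
  set (e := Rmin (Rmin d1 (rho / 2)) (Rmin (d / 8) c)).
  assert (He : 0 < e) by (repeat apply Rmin_pos; lra).
  assert (He1 : e <= d1 /\ e <= rho / 2 /\ e <= d / 8 /\ e <= c).
  { assert (L1 := Rmin_l d1 (rho / 2)). assert (L2 := Rmin_r d1 (rho / 2)).
    assert (L3 := Rmin_l (d / 8) c). assert (L4 := Rmin_r (d / 8) c).
    assert (L5 := Rmin_l (Rmin d1 (rho / 2)) (Rmin (d / 8) c)).
    assert (L6 := Rmin_r (Rmin d1 (rho / 2)) (Rmin (d / 8) c)). unfold e. lra. }
  clearbody e.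
  assert (Hzero : forall z, disc x e z -> exists k, is_derive f z k /\ Cmod k <= 0).
  { intros z Hz. unfold disc in Hz. destruct (Hhol z) as [k Hk]; [lra|].
    exists k. split; [assumption|]. right.
    destruct (classic (k = RtoC 0)) as [->|Hk0]; [apply Cmod_0|exfalso].
    assert (H1 : m / (2 * rho) <= Cmod k) by (apply (Hlow z); try assumption; lra).
    assert (H2 : Cmod k <= 2 * L * Cmod (z - x) / (d / 8)) by (apply Hcont; try assumption; lra).
    assert (H3 : 16 * L / d * Cmod (z - x) < 16 * L / d * c)
      by (apply Rmult_lt_compat_l; lra).
    replace (16 * L / d * c) with (m / (2 * rho)) in H3 by (unfold c; field; lra).
    replace (2 * L * Cmod (z - x) / (d / 8)) with (16 * L / d * Cmod (z - x)) in H2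
      by (field; lra). lra. }
  set (y := (x + RtoC (e / 2))%C).
  assert (Hy : Cmod (y - x) = e / 2).
  { unfold y. replace (x + RtoC (e / 2) - x)%C with (RtoC (e / 2)) by ring.
    rewrite Cmod_R. apply Rabs_pos_eq. lra. }
  assert (E : Cmod (f y - f x) <= 0 * Cmod (y - x)).
  { apply (mean_value_inequality f (disc x e)); try assumption.
    - apply disc_convex.
    - unfold disc. replace (x - x)%C with (RtoC 0) by ring. now rewrite Cmod_0.
    - unfold disc. lra. }
  rewrite Rmult_0_l in E.
  assert (E' : (f y - f x)%C = RtoC 0).
  { apply Cmod_eq_0. generalize (Cmod_ge_0 (f y - f x)). lra. }
  assert (Exy : y = x).
  { apply Hinj; unfold rho in *; try lra.
    replace (f y) with (f y - f x + f x)%C by ring. rewrite E'. ring. }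
  rewrite Exy in Hy. replace (x - x)%C with (RtoC 0) in Hy by ring.
  rewrite Cmod_0 in Hy. lra.
Qed.

(** * Holomorphic lifts *)

(** Inverse function rule for a lift that is known to be continuous only: divide
    the difference quotient of [h] by that of [f] along [g]. *)
Lemma is_C_derive_lift (f g h : C -> C) (a l m : C) :
  is_derive f (g a) l -> l <> RtoC 0 -> tends g a (g a) ->
  (exists d, 0 < d /\ forall z, Cmod (z - a) < d -> f (g z) = h z) ->
  is_derive h a m -> is_derive g a (m / l)%C.
Proof.
  intros Hf Hl Hg (d1 & Hd1 & Hfg) Hh.
  apply is_derive_tends. apply is_derive_tends in Hf, Hh.
  destruct (difference_quotient_extension f (g a) l Hf) as (phi & Hphi & Hcp & Hq).
  assert (Hpg : tends (fun z => phi (g z)) a l).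
  { rewrite <- Hphi. now apply tends_comp. }
  destruct (Hpg (Cmod l)) as (d2 & Hd2 & Hnz); [now apply Cmod_gt_0|].
  assert (Haa : f (g a) = h a).
  { apply Hfg. replace (a - a)%C with (RtoC 0) by ring. now rewrite Cmod_0. }
  apply tends_ext with (fun z => (h z - h a) / (z - a) / phi (g z))%C.
  - exists (Rmin d1 d2). split; [now apply Rmin_pos|]. intros z Hz Hlt.
    specialize (Hfg z (Rlt_le_trans _ _ _ Hlt (Rmin_l _ _))).
    specialize (Hnz z Hz (Rlt_le_trans _ _ _ Hlt (Rmin_r _ _))).
    assert (Hza := Cminus_neq_0 _ _ Hz).
    rewrite <- Hfg, <- Haa, Hq.
    assert (phi (g z) <> RtoC 0).
    { intros E. rewrite E in Hnz. replace (RtoC 0 - l)%C with (- l)%C in Hnz by ring.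
      rewrite Cmod_opp in Hnz. lra. }
    field. now split.
  - now apply tends_div.
Qed.

Lemma unit_disc_0 : unit_disc (RtoC 0).
Proof. unfold unit_disc. rewrite Cmod_0. lra. Qed.

Lemma unit_disc_open : open unit_disc.
Proof.
  apply open_Cmod. intros z Hz. unfold unit_disc in *.
  destruct (proj1 (open_Cmod _) (disc_open (RtoC 0) 1) z) as (d & Hd & H); unfold disc in *.
  - now replace (z - RtoC 0)%C with z by ring.
  - exists d. split; [assumption|]. intros y Hy. specialize (H y Hy).
    now replace (y - RtoC 0)%C with y in H by ring.
Qed.

Lemma ex_derive_lift (f h g : C -> C) (A : C -> Prop) :
  is_lift f A h unit_disc g ->
  (forall x, A x -> exists l, is_derive f x l /\ l <> RtoC 0) ->
  holomorphic_on unit_disc h -> holomorphic_on unit_disc g.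
Proof.
  intros Hg Hf Hh z Hz. destruct (Hg z Hz) as (G1 & G2 & G3).
  destruct (Hf _ G1) as (l & Hl & Hl0). destruct (Hh z Hz) as [m Hm].
  exists (m / l)%C. apply (is_C_derive_lift f g h z l m); try assumption.
  - now apply continuous_tends.
  - destruct (proj1 (open_Cmod _) unit_disc_open z Hz) as (d & Hd & H).
    exists d. split; [assumption|]. intros y Hy. now apply Hg, H.
Qed.

(** ** Square roots *)

(** The square root with positive real part on the right half plane, from the
    half-angle formulas. *)
Definition principal_sqrt (z : C) : C :=
  let a := sqrt ((Cmod z + fst z) / 2) in (a, snd z / (2 * a)).

Lemma principal_sqrt_spec (z : C) :
  0 < fst z -> (principal_sqrt z * principal_sqrt z)%C = z /\
    0 < fst (principal_sqrt z).
Proof.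
  intros Hz. assert (H1 := Rle_abs (fst z)). assert (H2 := Rabs_fst_le_Cmod z).
  assert (Ha : 0 < sqrt ((Cmod z + fst z) / 2)) by (apply sqrt_lt_R0; lra).
  split; [|exact Ha]. unfold principal_sqrt.
  assert (Hsq := sqrt_sqrt ((Cmod z + fst z) / 2) ltac:(lra)).
  set (a := sqrt ((Cmod z + fst z) / 2)) in *.
  assert (Hm := Cmod2_alt z). unfold Re, Im in Hm.
  destruct z as [x y]. simpl in Hz, Hsq, Hm |- *. unfold Cmult. simpl. f_equal.
  - apply Rmult_eq_reg_r with (4 * (a * a)); [|nra].
    replace ((a * a - y / (2 * a) * (y / (2 * a))) * (4 * (a * a)))
      with (4 * (a * a) * (a * a) - y * y) by (field; lra).
    rewrite Hsq. nra.
  - field. lra.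
Qed.

(** Between square roots in the right half plane, [s - t = (z - w) / (s + t)]. *)
Lemma principal_sqrt_continuous (z : C) : 0 < fst z -> continuous principal_sqrt z.
Proof.
  intros Hz. apply continuous_tends. intros eps He.
  destruct (principal_sqrt_spec z Hz) as [Sz Pz].
  set (a := fst (principal_sqrt z)) in *.
  exists (Rmin (fst z) (eps * a)).
  split; [apply Rmin_pos; [assumption|now apply Rmult_lt_0_compat]|].
  intros w _ Hw. assert (L1 := Rmin_l (fst z) (eps * a)). assert (L2 := Rmin_r (fst z) (eps * a)).
  assert (Hwp : 0 < fst w).
  { assert (H := Rabs_fst_le_Cmod (w - z)). simpl in H.
    assert (H' : Rabs (fst w + - fst z) < fst z)
      by (eapply Rle_lt_trans; [exact H|lra]). apply Rabs_def2 in H'. lra. }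
  destruct (principal_sqrt_spec w Hwp) as [Sw Pw].
  assert (Hsum : a < Cmod (principal_sqrt w + principal_sqrt z)).
  { eapply Rlt_le_trans; [|apply Rabs_fst_le_Cmod].
    eapply Rlt_le_trans; [|apply Rle_abs].
    change (a < fst (principal_sqrt w) + a). lra. }
  assert (Hn := Cmod_ge_0 (principal_sqrt w - principal_sqrt z)).
  apply Rmult_lt_reg_r with a; [assumption|].
  apply Rle_lt_trans with (Cmod (principal_sqrt w - principal_sqrt z)
                           * Cmod (principal_sqrt w + principal_sqrt z)).
  - apply Rmult_le_compat_l; lra.
  - rewrite <- Cmod_mult.
    replace ((principal_sqrt w - principal_sqrt z) * (principal_sqrt w + principal_sqrt z))%C
      with (w - z)%C by (rewrite <- Sw at 1; rewrite <- Sz at 1; ring). lra.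
Qed.

Definition square (z : C) : C := (z * z)%C.

Lemma is_derive_square (x : C) : is_derive square x (RtoC 2 * x)%C.
Proof.
  replace (RtoC 2 * x)%C with (RtoC 1 * x + x * RtoC 1)%C
    by (replace (RtoC 2) with (RtoC 1 + RtoC 1)%C
          by (rewrite <- RtoC_plus; f_equal; lra); ring).
  apply is_C_derive_mult; apply is_C_derive_id.
Qed.

Lemma Cmult_integral (x y : C) : (x * y)%C = RtoC 0 -> x = RtoC 0 \/ y = RtoC 0.
Proof.
  intros E. destruct (classic (x = RtoC 0)) as [|Hx]; [now left|right].
  apply NNPP. intros Hy. exact (Cmult_neq_0 _ _ Hx Hy E).
Qed.

(** If [y ^ 2 = z ^ 2] and [y <> z] then [y = - z], and [y], [z] cannot both be
    closer to [x] than the origin. *)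
Lemma square_locally_injective : locally_injective square (fun z => z <> RtoC 0).
Proof.
  intros x Hx. exists (disc x (Cmod x)). split; [apply disc_open|].
  assert (Hp : 0 < Cmod x) by now apply Cmod_gt_0.
  split. { unfold disc. replace (x - x)%C with (RtoC 0) by ring. now rewrite Cmod_0. }
  intros y z Hy Hz E. unfold disc, square in *.
  assert (E' : ((y - z) * (y + z))%C = RtoC 0).
  { replace ((y - z) * (y + z))%C with (y * y - z * z)%C by ring. rewrite E. ring. }
  destruct (Cmult_integral _ _ E') as [H|H].
  - replace y with (y - z + z)%C by ring. rewrite H. ring.
  - exfalso. assert (T := Cmod_triangle (y - x) (z - x)).
    replace (y - x + (z - x))%C with ((y + z) + - (x + x))%C in T by ring.
    rewrite H in T. replace (RtoC 0 + - (x + x))%C with (- (RtoC 2 * x))%C in T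
      by (replace (RtoC 2) with (RtoC 1 + RtoC 1)%C
          by (rewrite <- RtoC_plus; f_equal; lra); ring).
    rewrite Cmod_opp, Cmod_mult, Cmod_R, Rabs_pos_eq in T by lra. lra.
Qed.

(** For [u] and [x ^ 2] close to [w], the quotient [u / x ^ 2] lies in the right
    half plane, so [x] times its principal root is a root of [u]. *)
Lemma square_local_sections :
  has_local_sections square (fun z => z <> RtoC 0) (fun z => z <> RtoC 0).
Proof.
  intros w Hw. assert (Hp : 0 < Cmod w) by now apply Cmod_gt_0.
  exists (disc w (Cmod w / 3)). split; [apply disc_open|].
  split. { unfold disc. replace (w - w)%C with (RtoC 0) by ring. rewrite Cmod_0. lra. }
  unfold disc. intros x Hx Hxw. set (v := square x) in *.
  assert (Hv0 : v <> RtoC 0) by now apply Cmult_neq_0.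
  assert (Hv : 2 * Cmod w / 3 < Cmod v).
  { assert (T := Cmod_triangle (w - v) v). replace (w - v + v)%C with w in T by ring.
    rewrite <- Cmod_opp in Hxw. replace (- (v - w))%C with (w - v)%C in Hxw by ring. lra. }
  assert (Hre : forall u, Cmod (u - w) < Cmod w / 3 -> 0 < fst (u / v)%C).
  { intros u Hu. assert (H1 : Cmod (u / v - RtoC 1) < 1).
    { replace (u / v - RtoC 1)%C with ((u - v) / v)%C by (field; assumption).
      rewrite Cmod_div by assumption. apply Rmult_lt_reg_r with (Cmod v); [lra|].
      unfold Rdiv. rewrite Rmult_assoc, Rinv_l, Rmult_1_r, Rmult_1_l by lra.
      assert (T := Cmod_triangle (u - w) (- (v - w))). rewrite Cmod_opp in T.
      replace (u - w + - (v - w))%C with (u - v)%C in T by ring. lra. }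
    assert (H2 := Rabs_fst_le_Cmod (u / v - RtoC 1)).
    assert (H3 : Rabs (fst (u / v - RtoC 1)%C) < 1) by lra.
    apply Rabs_def2 in H3.
    replace (fst (u / v - RtoC 1)%C) with (fst (u / v)%C - 1) in H3 by (simpl; ring). lra. }
  exists (fun u => x * principal_sqrt (u / v))%C. split.
  - replace (v / v)%C with (RtoC 1) by (field; assumption).
    replace (principal_sqrt (RtoC 1)) with (RtoC 1); [ring|].
    unfold principal_sqrt. rewrite Cmod_1. unfold RtoC. simpl.
    replace ((1 + 1) / 2) with 1 by lra. rewrite sqrt_1. f_equal. field.
  - intros u Hu. specialize (Hre u Hu).
    destruct (principal_sqrt_spec _ Hre) as [S P]. repeat split.
    + intros E. destruct (Cmult_integral _ _ E) as [H|H]; [contradiction|].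
      rewrite H in P. simpl in P. lra.
    + unfold square.
      replace (x * principal_sqrt (u / v) * (x * principal_sqrt (u / v)))%C
        with (v * (principal_sqrt (u / v) * principal_sqrt (u / v)))%C
        by (unfold v, square; ring).
      rewrite S. field. assumption.
    + apply continuous_tends.
      apply (tends_mult (fun _ => x) (fun u => principal_sqrt (u / v))); [apply tends_const|].
      apply (tends_comp principal_sqrt (fun u => u / v)%C).
      * apply tends_div; [apply tends_id|apply tends_const|assumption].
      * now apply continuous_tends, principal_sqrt_continuous.
Qed.

Theorem holomorphic_sqrt (g : C -> C) :
  holomorphic_on unit_disc g -> (forall z, unit_disc z -> g z <> RtoC 0) ->
  g (RtoC 0) = RtoC 1 ->
  exists s, holomorphic_on unit_disc s /\ s (RtoC 0) = RtoC 1 /\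
    forall z, unit_disc z -> (s z * s z)%C = g z.
Proof.
  intros Hg Hg0 Hg1.
  destruct (disc_lift square (fun z => z <> RtoC 0) (fun z => z <> RtoC 0) g (RtoC 1))
    as (s & Hs & Hs0).
  - apply square_locally_injective.
  - apply square_local_sections.
  - intros z Hz. split; [now apply Hg0|]. now apply continuous_tends, ex_derive_tends, Hg.
  - intros E. injection E. lra.
  - rewrite Hg1. unfold square. ring.
  - exists s. split; [|split; [assumption|intros z Hz; now apply Hs]].
    apply (ex_derive_lift square g s _ Hs); [|assumption].
    intros x Hx. exists (RtoC 2 * x)%C. split; [apply is_derive_square|].
    apply Cmult_neq_0; [|assumption]. intros E. injection E. lra.
Qed.

(** ** The Schwarz-Pick lemma, up to a constant factor *)

(** Apply the maximum principle on [|z| = 1 / 2] to the Moebius transform of [G]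
    that vanishes at the origin, divided by [z]. *)
Lemma schwarz_pick (G : C -> C) (m : C) :
  holomorphic_on unit_disc G -> maps_to G unit_disc unit_disc ->
  is_derive G (RtoC 0) m -> Cmod m <= 2 * (1 - Cmod (G (RtoC 0)) ^ 2).
Proof.
  intros HG Hmaps Hm. set (z0 := G (RtoC 0)) in *.
  assert (Hz0 : Cmod z0 < 1) by (apply Hmaps, unit_disc_0).
  assert (Hz0p := Cmod_ge_0 z0).
  assert (Hden : forall x, Cmod x < 1 -> (RtoC 1 - Cconj z0 * x)%C <> RtoC 0).
  { intros x Hx E. assert (H : (Cconj z0 * x)%C = RtoC 1).
    { replace (Cconj z0 * x)%C with (RtoC 1 - (RtoC 1 - Cconj z0 * x))%C by ring.
      rewrite E. ring. }
    apply (f_equal Cmod) in H. rewrite Cmod_mult, Cmod_conj, Cmod_1 in H.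
    generalize (Cmod_ge_0 x). nra. }
  assert (Hd0 : (RtoC 1 - Cconj z0 * z0)%C = RtoC (1 - Cmod z0 ^ 2)).
  { rewrite RtoC_minus, RtoC_pow. f_equal. rewrite <- RtoC_pow, Cmod2_conj. ring. }
  assert (Hmob : forall x, Cmod x < 1 -> Cmod (x - z0) <= Cmod (RtoC 1 - Cconj z0 * x)).
  { intros x Hx. apply Rsqr_incr_0; try apply Cmod_ge_0. rewrite !Rsqr_pow2, !Cmod2_alt.
    assert (Hx2 := Cmod2_alt x). assert (Hz2 := Cmod2_alt z0).
    assert (Hxp := Cmod_ge_0 x).
    assert (Hx3 : Cmod x ^ 2 <= 1) by nra. assert (Hz3 : Cmod z0 ^ 2 <= 1) by nra.
    rewrite Hx2 in Hx3. rewrite Hz2 in Hz3. clear - Hx3 Hz3.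
    destruct x as [a b]. destruct z0 as [c d]. unfold Re, Im in *. simpl in *. nra. }
  enough (H : Cmod (m / (RtoC 1 - Cconj z0 * z0)) <= 2).
  { rewrite Hd0 in H. assert (Hpos : 0 < 1 - Cmod z0 ^ 2) by nra.
    rewrite Cmod_div, Cmod_R, Rabs_pos_eq in H;
      [|lra|intros E; injection E; lra].
    apply Rmult_le_compat_r with (r := 1 - Cmod z0 ^ 2) in H; [|lra].
    replace (Cmod m / (1 - Cmod z0 ^ 2) * (1 - Cmod z0 ^ 2)) with (Cmod m) in H
      by (field; lra). assumption. }
  apply (centre_maximum_principle
    (fun z => (G z - z0) / z / (RtoC 1 - Cconj z0 * G z))%C _ (1 / 2)); [lra| | |].
  - intros z Hz. assert (Hzd : unit_disc z) by (unfold unit_disc; lra).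
    apply ex_derive_div_C; [apply ex_derive_div_C| |].
    + apply ex_derive_minus_C; [now apply HG|apply ex_derive_const_C].
    + apply ex_derive_id_C.
    + now apply Cmod_gt_0.
    + apply ex_derive_minus_C; [apply ex_derive_const_C|].
      apply ex_derive_mult_C; [apply ex_derive_const_C|now apply HG].
    + now apply Hden, Hmaps.
  - apply tends_div.
    + apply is_derive_tends in Hm. revert Hm. apply tends_ext_all. intros z _.
      fold z0. f_equal. f_equal. ring.
    + apply tends_minus; [apply tends_const|]. apply tends_mult; [apply tends_const|].
      apply (is_derive_continuous _ _ _ Hm).
    + now apply Hden.
  - intros z Hz. assert (Hzd : unit_disc z) by (unfold unit_disc; lra).
    assert (Hz00 : z <> RtoC 0) by (apply Cmod_gt_0; lra).
    assert (HGz := Hmaps z Hzd). assert (Hd := Hden _ HGz).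
    rewrite !Cmod_div by assumption. rewrite Hz.
    assert (Hdp : 0 < Cmod (RtoC 1 - Cconj z0 * G z)) by now apply Cmod_gt_0.
    apply Rmult_le_reg_r with (Cmod (RtoC 1 - Cconj z0 * G z)); [assumption|].
    replace (Cmod (G z - z0) / (1 / 2) / Cmod (RtoC 1 - Cconj z0 * G z)
             * Cmod (RtoC 1 - Cconj z0 * G z)) with (2 * Cmod (G z - z0)) by (field; lra).
    specialize (Hmob _ HGz). lra.
Qed.

(** * The density of a covering *)

(** A local section is a continuous inverse, which is what
    [injective_derivative_neq_0] asks for. *)
Lemma covering_derivative_neq_0 (f : C -> C) (Omega : C -> Prop) (x l : C) :
  holomorphic_universal_covering f Omega -> unit_disc x -> is_derive f x l ->
  l <> RtoC 0.
Proof.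
  intros [Hhol Hcov] Hx Hl.
  destruct (covering_locally_injective _ _ _ Hcov x Hx) as (V & HVo & HVx & Hinj).
  assert (HB : Omega (f x)) by now apply Hcov.
  destruct (covering_has_local_sections _ _ _ Hcov _ HB) as (U & HUo & HUx & HU).
  destruct (HU x Hx HUx) as (s & Hsx & Hs).
  destruct (proj1 (open_Cmod V) HVo x HVx) as (d1 & Hd1 & HdV).
  destruct (proj1 (open_Cmod _) unit_disc_open x Hx) as (d2 & Hd2 & HdD).
  destruct (proj1 (open_Cmod U) HUo _ HUx) as (d3 & Hd3 & HdU).
  destruct (Hs _ HUx) as (_ & _ & Hsc).
  assert (L1 := Rmin_l d1 d2). assert (L2 := Rmin_r d1 d2).
  apply (injective_derivative_neq_0 f x l (Rmin d1 d2)); try assumption.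
  - now apply Rmin_pos.
  - unfold disc. intros z Hz. apply Hhol, HdD. lra.
  - unfold disc. intros y z Hy Hz. apply Hinj; apply HdV; lra.
  - unfold disc. intros rho Hrho.
    destruct (continuous_Cmod s _ Hsc (Rmin rho d1)) as (m & Hm & Hsm).
    { now apply Rmin_pos. }
    assert (L3 := Rmin_l rho d1). assert (L4 := Rmin_r rho d1).
    assert (L5 := Rmin_l m d3). assert (L6 := Rmin_r m d3).
    exists (Rmin m d3). split; [now apply Rmin_pos|]. intros z Hz Hfz.
    assert (Hclose : Cmod (s (f z) - x) < Rmin rho d1) by (rewrite <- Hsx; apply Hsm; lra).
    replace z with (s (f z)); [lra|].
    apply Hinj; [apply HdV; lra|apply HdV; lra|].
    apply Hs, HdU. lra.
Qed.

(** The lift [g] of the affine map of the unit disc onto the disc of radius [r]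
    round [f x] has [g' 0 = r / f' x]; apply the Schwarz-Pick lemma to it. *)
Theorem covering_derivative_bound (f : C -> C) (Omega : C -> Prop) (x l : C) (r : R) :
  holomorphic_universal_covering f Omega -> unit_disc x -> is_derive f x l ->
  0 < r -> (forall u, disc (f x) r u -> Omega u) ->
  r <= 2 * (1 - Cmod x ^ 2) * Cmod l.
Proof.
  intros Hf Hx Hl Hr Hdisc. destruct Hf as [Hhol Hcov].
  assert (Hl0 : l <> RtoC 0)
    by exact (covering_derivative_neq_0 f Omega x l (conj Hhol Hcov) Hx Hl).
  set (h := fun z => (f x + RtoC r * z)%C).
  assert (Hh : forall z, is_derive h z (RtoC r)).
  { intros z. apply is_C_derive_affine. }
  assert (Hh0 : h (RtoC 0) = f x) by (unfold h; ring).
  destruct (disc_lift f unit_disc Omega h x) as (g & Hg & Hg0).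
  - exact (covering_locally_injective _ _ _ Hcov).
  - exact (covering_has_local_sections _ _ _ Hcov).
  - intros z Hz. split.
    + apply Hdisc. unfold disc, h. replace (f x + RtoC r * z - f x)%C with (RtoC r * z)%C by ring.
      rewrite Cmod_mult, Cmod_R, Rabs_pos_eq by lra. unfold unit_disc in Hz. nra.
    + apply continuous_tends, ex_derive_tends. eexists. apply Hh.
  - assumption.
  - now symmetry.
  - assert (Hghol : holomorphic_on unit_disc g).
    { apply (ex_derive_lift f h g unit_disc Hg).
      - intros y Hy. destruct (Hhol y Hy) as [k Hk]. exists k. split; [assumption|].
        exact (covering_derivative_neq_0 f Omega y k (conj Hhol Hcov) Hy Hk).
      - intros z _. eexists. apply Hh. }
    assert (Hgd : is_derive g (RtoC 0) (RtoC r / l)%C).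
    { apply (is_C_derive_lift f g h (RtoC 0) l (RtoC r)).
      - now rewrite Hg0.
      - assumption.
      - now apply ex_derive_tends, Hghol, unit_disc_0.
      - exists 1. split; [lra|]. intros z Hz. apply Hg. unfold unit_disc.
        now replace (z - RtoC 0)%C with z in Hz by ring.
      - apply Hh. }
    assert (Hsp := schwarz_pick g _ Hghol (fun z Hz => proj1 (Hg z Hz)) Hgd).
    rewrite Hg0, Cmod_div, Cmod_R, Rabs_pos_eq in Hsp by (assumption || lra).
    assert (Hlp : 0 < Cmod l) by now apply Cmod_gt_0.
    apply Rmult_le_compat_r with (r := Cmod l) in Hsp; [|lra].
    replace (r / Cmod l * Cmod l) with r in Hsp by (field; lra). assumption.
Qed.

(** * Hurwitz's theorem *)

Lemma polar_form (z : C) (r : R) :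
  0 < r -> Cmod z = r -> exists y, - PI <= y <= PI /\ z = cexp (ln r, y).
Proof.
  intros Hr Hz. assert (Hm := Cmod2_alt z). rewrite Hz in Hm.
  destruct z as [a b]. unfold Re, Im in Hm. simpl in Hm.
  assert (Ha : -1 <= a / r <= 1).
  { assert (-r <= a <= r) by (split; nra).
    split; apply Rmult_le_reg_r with r; try assumption; field_simplify; lra. }
  assert (Hac := acos_bound (a / r)). assert (Hcos := cos_acos (a / r) Ha).
  assert (Hsin := sin_acos (a / r) Ha).
  assert (Hb : sqrt (1 - (a / r)²) = Rabs b / r).
  { rewrite <- (sqrt_Rsqr (Rabs b / r)).
    - f_equal. unfold Rsqr, Rdiv.
      replace (Rabs b * / r * (Rabs b * / r)) with (Rabs b * Rabs b * (/ r * / r)) by ring.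
      rewrite <- Rabs_mult, Rabs_pos_eq by nra. field_simplify_eq; [nra|lra].
    - apply Rmult_le_pos; [apply Rabs_pos|left; now apply Rinv_0_lt_compat]. }
  destruct (Rle_lt_dec 0 b) as [Hb0|Hb0].
  - exists (acos (a / r)). split; [lra|]. unfold cexp. simpl.
    rewrite exp_ln, Hcos, Hsin, Hb, Rabs_pos_eq by assumption.
    f_equal; field; lra.
  - exists (- acos (a / r)). split; [lra|]. unfold cexp. simpl.
    rewrite exp_ln, cos_neg, sin_neg, Hcos, Hsin, Hb, Rabs_left by assumption.
    f_equal; field; lra.
Qed.

(** The circle is the continuous image of a compact interval. *)
Lemma bounded_on_circle (F : C -> C) (r : R) :
  0 < r -> (forall z, Cmod z = r -> ex_derive F z) ->
  exists M, forall z, Cmod z = r -> Cmod (F z) <= M.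
Proof.
  intros Hr HF. assert (HPI := PI_RGT_0).
  assert (Hc : forall y, continuous (fun y => fst (F (cexp (ln r, y)))) y /\
                         continuous (fun y => snd (F (cexp (ln r, y)))) y).
  { intros y. apply (continuous_section (fun z => F (cexp z)) (fun _ => ln r) (fun y => y)).
    - apply (ex_derive_comp_C F cexp); [|eexists; apply is_C_derive_cexp].
      apply HF. rewrite Cmod_cexp. now apply exp_ln.
    - apply continuous_const.
    - apply continuous_id. }
  destruct (continuity_ab_maj (fun y => Rabs (fst (F (cexp (ln r, y))))) (- PI) PI)
    as (y1 & H1 & _); [lra| |].
  { intros y _. apply (continuity_pt_comp (fun y => fst (F (cexp (ln r, y)))) Rabs).
    - apply continuity_pt_filterlim. apply (Hc y).
    - apply Rcontinuity_abs. }
  destruct (continuity_ab_maj (fun y => Rabs (snd (F (cexp (ln r, y))))) (- PI) PI)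
    as (y2 & H2 & _); [lra| |].
  { intros y _. apply (continuity_pt_comp (fun y => snd (F (cexp (ln r, y)))) Rabs).
    - apply continuity_pt_filterlim. apply (Hc y).
    - apply Rcontinuity_abs. }
  eexists. intros z Hz. destruct (polar_form z r Hr Hz) as (y & Hy & ->).
  rewrite (surjective_pairing (F (cexp (ln r, y)))).
  eapply Rle_trans; [apply Cmod_le_Rabs|].
  apply Rplus_le_compat; [now apply H1|now apply H2].
Qed.

(** The class of Hurwitz's theorem, but with a zero [c z ^ n + ...] of any order at
    the origin, because the Landen step doubles the order. *)
Definition hurwitz_class (n : nat) (f : C -> C) (c : C) : Prop :=
  holomorphic_on unit_disc f /\ f (RtoC 0) = RtoC 0 /\
  (forall z, unit_disc z -> z <> RtoC 0 -> f z <> RtoC 0) /\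
  (forall z, unit_disc z -> f z <> RtoC 1) /\
  tends (fun z => f z / z ^ n)%C (RtoC 0) c.

Lemma RtoC_2 : RtoC 2 = (RtoC 1 + RtoC 1)%C.
Proof. rewrite <- RtoC_plus. apply f_equal. lra. Qed.

Lemma Cplus_self_neq_0 : (RtoC 1 + RtoC 1)%C <> RtoC 0.
Proof. rewrite <- RtoC_2. intros E. injection E. lra. Qed.

(** With [s = sqrt (1 - f)], the function [w = (1 - s) / (1 + s)] solves
    [4 w / (1 + w) ^ 2 = f] and omits [1] and [-1].  Where [f] is large, [s]
    is large and [w] is close to [-1]; so the bounds depend on the small values of
    [f] only, and squaring [w] doubles the order of the zero. *)
Lemma hurwitz_class_double (n : nat) (f : C -> C) (c : C) :
  hurwitz_class n f c -> exists f', hurwitz_class (2 * n) f' (c * c / RtoC 16)%C /\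
    forall z, unit_disc z -> z <> RtoC 0 ->
      Cmod (f' z) <= (2 + 4 / Cmod (f z)) ^ 2 /\
      / Cmod (f' z) <= (2 + 4 / Cmod (f z)) ^ 2.
Proof.
  intros (Hf & Hf0 & Hfz & Hf1 & Hc).
  destruct (holomorphic_sqrt (fun z => RtoC 1 - f z)%C) as (s & Hs & Hs0 & Hss).
  - intros z Hz. apply ex_derive_minus_C; [apply ex_derive_const_C|now apply Hf].
  - intros z Hz E. apply (Hf1 z Hz).
    replace (f z) with (RtoC 1 - (RtoC 1 - f z))%C by ring. rewrite E. ring.
  - rewrite Hf0. ring.
  - assert (Hfs : forall z, unit_disc z -> f z = ((RtoC 1 - s z) * (RtoC 1 + s z))%C).
    { intros z Hz. replace (f z) with (RtoC 1 - (RtoC 1 - f z))%C by ring.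
      rewrite <- Hss by assumption. ring. }
    assert (Hp : forall z, unit_disc z -> (RtoC 1 + s z)%C <> RtoC 0).
    { intros z Hz E. destruct (classic (z = RtoC 0)) as [->|Hz0].
      - rewrite Hs0 in E. now apply Cplus_self_neq_0.
      - apply (Hfz z Hz Hz0). rewrite Hfs by assumption. rewrite E. ring. }
    assert (Hm : forall z, unit_disc z -> z <> RtoC 0 -> (RtoC 1 - s z)%C <> RtoC 0).
    { intros z Hz Hz0 E. apply (Hfz z Hz Hz0). rewrite Hfs by assumption. rewrite E. ring. }
    set (w := fun z => ((RtoC 1 - s z) / (RtoC 1 + s z))%C).
    assert (Hwd : holomorphic_on unit_disc w).
    { intros z Hz. apply ex_derive_div_C; [| |now apply Hp].
      - apply ex_derive_minus_C; [apply ex_derive_const_C|now apply Hs].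
      - apply ex_derive_plus_C; [apply ex_derive_const_C|now apply Hs]. }
    exists (fun z => w z * w z)%C. split; [repeat split|].
    + intros z Hz. apply ex_derive_mult_C; now apply Hwd.
    + unfold w. rewrite Hs0. unfold Cdiv. ring.
    + intros z Hz Hz0.
      assert (w z <> RtoC 0).
      { intros E. apply (Hm z Hz Hz0).
        replace (RtoC 1 - s z)%C with (w z * (RtoC 1 + s z))%C
          by (unfold w; field; now apply Hp). rewrite E. ring. }
      now apply Cmult_neq_0.
    + intros z Hz E.
      assert (E' : ((w z - RtoC 1) * (w z + RtoC 1))%C = RtoC 0).
      { replace ((w z - RtoC 1) * (w z + RtoC 1))%C with (w z * w z - RtoC 1)%C by ring.
        rewrite E. ring. }
      assert (Hpz := Hp z Hz).
      destruct (Cmult_integral _ _ E') as [H|H].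
      * apply (Hf1 z Hz). rewrite Hfs by assumption.
        assert (H' : (s z + s z)%C = RtoC 0).
        { replace (s z + s z)%C with (- ((w z - RtoC 1) * (RtoC 1 + s z)))%C
            by (unfold w; field; assumption). rewrite H. ring. }
        replace (s z + s z)%C with ((RtoC 1 + RtoC 1) * s z)%C in H' by ring.
        destruct (Cmult_integral _ _ H') as [H2|H2]; [destruct (Cplus_self_neq_0 H2)|].
        rewrite H2. ring.
      * apply Cplus_self_neq_0.
        replace (RtoC 1 + RtoC 1)%C with ((w z + RtoC 1) * (RtoC 1 + s z))%C
          by (unfold w; field; assumption). rewrite H. ring.
    + apply tends_ext with (fun z => (f z / z ^ n) * (f z / z ^ n) /
        ((RtoC 1 + s z) * (RtoC 1 + s z) * ((RtoC 1 + s z) * (RtoC 1 + s z))))%C.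
      * exists 1. split; [lra|]. intros z Hz Hlt.
        replace (z - RtoC 0)%C with z in Hlt by ring.
        assert (Hpz := Hp z Hlt). assert (Hzn : (z ^ n)%C <> RtoC 0) by now apply Cpow_nz.
        replace (2 * n)%nat with (n + n)%nat by lia. rewrite Cpow_add_r.
        rewrite (Hfs z Hlt). unfold w. field. split; assumption.
      * assert (Hst : tends s (RtoC 0) (RtoC 1)).
        { rewrite <- Hs0. now apply ex_derive_tends, Hs, unit_disc_0. }
        assert (Hst1 := tends_plus _ _ _ _ _ (tends_const (RtoC 0) (RtoC 1)) Hst).
        replace (c * c / RtoC 16)%C
          with (c * c / ((RtoC 1 + RtoC 1) * (RtoC 1 + RtoC 1)
                         * ((RtoC 1 + RtoC 1) * (RtoC 1 + RtoC 1))))%C.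
        -- apply tends_div; [now apply tends_mult| |].
           ++ now apply tends_mult; apply tends_mult.
           ++ repeat apply Cmult_neq_0; apply Cplus_self_neq_0.
        -- f_equal. rewrite <- RtoC_2, <- !RtoC_mult. f_equal. lra.
    + intros z Hz Hz0.
      assert (Hfz0 := Hfz z Hz Hz0). assert (Hpz := Hp z Hz). assert (Hmz := Hm z Hz Hz0).
      assert (Hfp : 0 < Cmod (f z)) by now apply Cmod_gt_0.
      assert (Hs2 : Cmod (s z) ^ 2 <= 1 + Cmod (f z)).
      { simpl. rewrite Rmult_1_r, <- Cmod_mult, Hss by assumption.
        eapply Rle_trans; [apply Cmod_triangle|]. rewrite Cmod_opp, Cmod_1. lra. }
      assert (Hbound : forall t, Cmod t <= 1 + Cmod (s z) ->
        Cmod (t * t / f z) <= 2 + 4 / Cmod (f z)).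
      { intros t Ht. rewrite Cmod_div, Cmod_mult by assumption.
        apply Rmult_le_reg_r with (Cmod (f z)); [assumption|].
        replace (Cmod t * Cmod t / Cmod (f z) * Cmod (f z)) with (Cmod t * Cmod t)
          by (field; lra).
        replace ((2 + 4 / Cmod (f z)) * Cmod (f z)) with (2 * Cmod (f z) + 4)
          by (field; lra).
        assert (Ht0 := Cmod_ge_0 t). assert (Hsp := Cmod_ge_0 (s z)).
        assert (Cmod t * Cmod t <= (1 + Cmod (s z)) * (1 + Cmod (s z))) by nra. nra. }
      assert (Hw1 : Cmod (w z) <= 2 + 4 / Cmod (f z)).
      { replace (w z) with ((RtoC 1 - s z) * (RtoC 1 - s z) / f z)%C.
        - apply Hbound. eapply Rle_trans; [apply Cmod_triangle|].
          rewrite Cmod_opp, Cmod_1. lra.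
        - rewrite Hfs by assumption. unfold w. field. now split. }
      assert (Hw2 : / Cmod (w z) <= 2 + 4 / Cmod (f z)).
      { assert (w z <> RtoC 0).
        { intros E. apply Hmz.
          replace (RtoC 1 - s z)%C with (w z * (RtoC 1 + s z))%C
            by (unfold w; field; assumption). rewrite E. ring. }
        rewrite <- Cmod_inv by assumption.
        replace (/ w z)%C with ((RtoC 1 + s z) * (RtoC 1 + s z) / f z)%C.
        - apply Hbound. eapply Rle_trans; [apply Cmod_triangle|].
          rewrite Cmod_1. lra.
        - rewrite Hfs by assumption. unfold w. field. now split. }
      rewrite Cmod_mult, Rinv_mult. assert (Hw0 := Cmod_ge_0 (w z)).
      assert (Hwi : 0 <= / Cmod (w z)).
      { destruct (Req_dec (Cmod (w z)) 0) as [E|E]; [rewrite E, Rinv_0; lra|].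
        left. apply Rinv_0_lt_compat. lra. }
      split; simpl; rewrite Rmult_1_r; apply Rmult_le_compat; assumption.
Qed.

(** The factor 36 turns the recursion of the bounds into squaring: if
    [q <= Q] and [1 <= Q], then [(2 + 4 q) ^ 2 <= 36 Q ^ 2]. *)
Lemma hurwitz_class_iterate (f : C -> C) (c : C) (N : R) :
  hurwitz_class 1 f c -> 1 <= N ->
  (forall z, Cmod z = 1 / 2 -> Cmod (f z) <= N /\ / Cmod (f z) <= N) ->
  forall k, exists fk ck, hurwitz_class (2 ^ k) fk ck /\
    Cmod ck = 16 * (Cmod c / 16) ^ (2 ^ k) /\
    forall z, Cmod z = 1 / 2 ->
      Cmod (fk z) <= (36 * N) ^ (2 ^ k) / 36 /\
      / Cmod (fk z) <= (36 * N) ^ (2 ^ k) / 36.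
Proof.
  intros Hf HN Hb k. induction k as [|k (fk & ck & Hk & Hck & Hbk)].
  - exists f, c. split; [exact Hf|]. simpl. rewrite !Rmult_1_r. split; [lra|].
    intros z Hz. specialize (Hb z Hz). lra.
  - destruct (hurwitz_class_double _ _ _ Hk) as (f' & Hf' & Hbf').
    exists f', (ck * ck / RtoC 16)%C.
    replace (2 ^ S k)%nat with (2 * 2 ^ k)%nat by reflexivity.
    split; [assumption|].
    set (n := (2 ^ k)%nat) in *. replace (2 * n)%nat with (n + n)%nat by lia.
    rewrite !pow_add. split.
    + rewrite Cmod_div, Cmod_mult, Hck, Cmod_R, Rabs_pos_eq; [field|lra|].
      intros E. injection E. lra.
    + intros z Hz. assert (Hzd : unit_disc z) by (unfold unit_disc; lra).
      assert (Hz0 : z <> RtoC 0) by (apply Cmod_gt_0; lra).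
      destruct (Hbf' z Hzd Hz0) as [H1 H2]. destruct (Hbk z Hz) as [_ H3].
      set (Q := (36 * N) ^ n / 36) in *.
      assert (HQ : 1 <= Q).
      { unfold Q. assert (HB : 36 ^ 1 <= (36 * N) ^ n).
        { apply Rle_trans with (36 ^ n); [|apply pow_incr; lra].
          apply Rle_pow; [lra|]. unfold n. assert (H := Nat.pow_nonzero 2 k). lia. }
        lra. }
      assert (HE : (36 * N) ^ n * (36 * N) ^ n / 36 = (6 * Q) ^ 2) by (unfold Q; field).
      rewrite HE.
      assert (Hfi : 0 <= / Cmod (fk z)).
      { left. apply Rinv_0_lt_compat, Cmod_gt_0. now apply Hk. }
      assert (H4 : (2 + 4 / Cmod (fk z)) ^ 2 <= (6 * Q) ^ 2)
        by (apply pow_incr; unfold Rdiv; lra).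
      lra.
Qed.

(** Each square root halves the leading coefficient of [g - 1], since
    [s - 1 = (s ^ 2 - 1) / (s + 1)] and [s + 1] tends to 2. *)
Lemma holomorphic_root (g : C -> C) (n : nat) (c : C) :
  holomorphic_on unit_disc g -> (forall z, unit_disc z -> g z <> RtoC 0) ->
  g (RtoC 0) = RtoC 1 -> tends (fun z => (g z - RtoC 1) / z ^ n)%C (RtoC 0) c ->
  forall k, exists S, holomorphic_on unit_disc S /\ S (RtoC 0) = RtoC 1 /\
    (forall z, unit_disc z -> (S z ^ (2 ^ k))%C = g z) /\
    tends (fun z => (S z - RtoC 1) / z ^ n)%C (RtoC 0) (c / RtoC 2 ^ k)%C.
Proof.
  intros Hg Hg0 Hg1 Hc k. induction k as [|k (S & HS & HS0 & HSk & HSc)].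
  - exists g. repeat split; try assumption; simpl.
    + intros z _. ring.
    + replace (c / RtoC 1)%C with c by (field; intros E; injection E; lra). assumption.
  - destruct (holomorphic_sqrt S HS) as (s & Hs & Hs0 & Hss); [|assumption|].
    { intros z Hz E. apply (Hg0 z Hz). rewrite <- HSk, E by assumption.
      assert (Hk := Nat.pow_nonzero 2 k). destruct (2 ^ k)%nat; [lia|]. simpl. ring. }
    exists s. repeat split; try assumption.
    + intros z Hz. replace (2 ^ Datatypes.S k)%nat with (2 * 2 ^ k)%nat by reflexivity.
      rewrite Cpow_mult_r. simpl. rewrite Cmult_1_r, Hss by assumption. now apply HSk.
    + assert (Hst : tends (fun z => RtoC 1 + s z)%C (RtoC 0) (RtoC 1 + RtoC 1)%C).
      { apply tends_plus; [apply tends_const|].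
        rewrite <- Hs0. now apply ex_derive_tends, Hs, unit_disc_0. }
      apply tends_eq with (c / RtoC 2 ^ k / (RtoC 1 + RtoC 1))%C.
      { simpl. rewrite RtoC_2. assert (Ht := Cplus_self_neq_0).
        set (t := (RtoC 1 + RtoC 1)%C) in *. clearbody t.
        assert (Htk := Cpow_nz t k Ht). field. now split. }
      assert (Hst' := Hst).
      destruct (Hst' (Cmod (RtoC 1 + RtoC 1)%C)) as (d & Hd & Hnz).
      { apply Cmod_gt_0, Cplus_self_neq_0. }
      apply tends_ext with (fun z => (S z - RtoC 1) / z ^ n / (RtoC 1 + s z))%C.
      * exists (Rmin 1 d). split; [apply Rmin_pos; lra|]. intros z Hz Hlt.
        specialize (Hnz z Hz (Rlt_le_trans _ _ _ Hlt (Rmin_r _ _))).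
        assert (Hzd : unit_disc z).
        { unfold unit_disc. replace (z - RtoC 0)%C with z in Hlt by ring.
          eapply Rlt_le_trans; [exact Hlt|apply Rmin_l]. }
        rewrite <- Hss by assumption. field. split; [now apply Cpow_nz|].
        intros E. rewrite E in Hnz. revert Hnz.
        replace (RtoC 0 - (RtoC 1 + RtoC 1))%C with (- (RtoC 1 + RtoC 1))%C by ring.
        rewrite Cmod_opp. lra.
      * apply tends_div; [assumption|assumption|apply Cplus_self_neq_0].
Qed.

(** By Bernoulli's inequality [x ^ n >= 1 + n t] with [x = 1 + t], so
    [x ^ (2 n) >= n ^ 2 t ^ 2] grows faster than any multiple of [n]. *)
Lemma pow_pow2_unbounded (x K : R) :
  (forall k, x ^ (2 ^ k) <= K * 2 ^ k) -> x <= 1.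
Proof.
  intros H. apply Rnot_lt_le. intros Hx. set (t := x - 1).
  assert (Ht : 0 < t) by (unfold t; lra).
  assert (Hb : forall k, 2 ^ k * (t * t) <= 2 * K).
  { intros k. assert (Hp : 0 < 2 ^ k) by (apply pow_lt; lra).
    specialize (H (S k)). replace (2 ^ S k)%nat with (2 ^ k + 2 ^ k)%nat in H by (simpl; lia).
    rewrite pow_add in H. assert (Hpoly := poly (2 ^ k) t Ht).
    replace (1 + t) with x in Hpoly by (unfold t; ring). rewrite pow_INR in Hpoly.
    replace (INR 2) with 2 in Hpoly by (simpl; lra). simpl (2 ^ S k) in H.
    assert (Hpt : 0 < 2 ^ k * t) by now apply Rmult_lt_0_compat.
    apply Rmult_le_reg_l with (2 ^ k); [assumption|].
    assert (2 ^ k * t * (2 ^ k * t) <= x ^ 2 ^ k * x ^ 2 ^ k)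
      by (apply Rmult_le_compat; lra).
    lra. }
  assert (Htt : 0 < t * t) by nra.
  destruct (INR_unbounded (2 * K / (t * t))) as [k Hk].
  assert (H2 : INR k <= 2 ^ k).
  { assert (HP := poly k 1 Rlt_0_1). replace (1 + 1) with 2 in HP by ring. lra. }
  specialize (Hb k). apply (Rmult_gt_compat_r (t * t)) in Hk; [|assumption].
  unfold Rdiv in Hk. rewrite Rmult_assoc, Rinv_l, Rmult_1_r in Hk by lra. nra.
Qed.

(** The [n]-th root of one minus the [k]-th iterate is bounded on [|z| = 1 / 2]
    independently of [n = 2 ^ k].  So its coefficient of order [n] is at most a
    constant times [2 ^ n], whereas the iteration makes it [16 (|c| / 16) ^ n / n]. *)
Theorem hurwitz_omits_one (f : C -> C) (c : C) :
  hurwitz_class 1 f c -> Cmod c <= 32.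
Proof.
  intros Hf. assert (Hhalf : 0 < 1 / 2) by lra.
  destruct (bounded_on_circle f (1 / 2) Hhalf) as [M1 HM1].
  { intros z Hz. apply Hf. unfold unit_disc. lra. }
  destruct (bounded_on_circle (fun z => RtoC 1 / f z)%C (1 / 2) Hhalf) as [M2 HM2].
  { intros z Hz. apply ex_derive_div_C; [apply ex_derive_const_C| |];
      apply Hf; try (unfold unit_disc; lra). apply Cmod_gt_0. lra. }
  set (N := Rmax 1 (Rmax M1 M2)).
  assert (HN1 : 1 <= N) by apply Rmax_l.
  assert (HN2 : M1 <= N /\ M2 <= N).
  { unfold N. split; (eapply Rle_trans; [|apply Rmax_r]); [apply Rmax_l|apply Rmax_r]. }
  assert (Hit := hurwitz_class_iterate f c N Hf HN1).
  enough (Hx : Cmod c / 32 <= 1) by lra.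
  apply pow_pow2_unbounded with (36 * N + 1).
  intros k. destruct Hit with k as (fk & ck & Hk & Hck & Hbk).
  { intros z Hz. assert (Hz0 : f z <> RtoC 0).
    { apply Hf; [unfold unit_disc; lra|]. apply Cmod_gt_0. lra. }
    specialize (HM1 z Hz). specialize (HM2 z Hz).
    rewrite Cmod_div, Cmod_1 in HM2 by assumption. unfold Rdiv in HM2. lra. }
  set (n := (2 ^ k)%nat) in *.
  assert (Hn : n <> O) by (apply Nat.pow_nonzero; lia).
  destruct Hk as (Hhol & Hk0 & _ & Hk1 & Hkc).
  destruct (holomorphic_root (fun z => RtoC 1 - fk z)%C n (- ck)%C) with k
    as (S & HS & HS0 & HSk & HSc).
  - intros z Hz. apply ex_derive_minus_C; [apply ex_derive_const_C|now apply Hhol].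
  - intros z Hz E. apply (Hk1 z Hz).
    replace (fk z) with (RtoC 1 - (RtoC 1 - fk z))%C by ring. rewrite E. ring.
  - rewrite Hk0. ring.
  - apply tends_opp in Hkc. revert Hkc. apply tends_ext_all. intros z Hz.
    field. now apply Cpow_nz.
  - fold n in HSk.
    assert (H2k : 0 < 2 ^ k) by (apply pow_lt; lra).
    assert (Hest : Cmod (- ck / RtoC 2 ^ k) <= (36 * N + 1) * 2 ^ n).
    { apply (centre_maximum_principle (fun z => (S z - RtoC 1) / z ^ n)%C _ (1 / 2));
        try assumption.
      - intros z Hz. apply ex_derive_div_C.
        + apply ex_derive_minus_C; [|apply ex_derive_const_C]. apply HS.
          unfold unit_disc. lra.
        + apply ex_derive_pow_C, ex_derive_id_C.
        + apply Cpow_nz. now apply Cmod_gt_0.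
      - intros z Hz. assert (Hzd : unit_disc z) by (unfold unit_disc; lra).
        assert (Hz0 : z <> RtoC 0) by (apply Cmod_gt_0; lra).
        rewrite Cmod_div by now apply Cpow_nz. rewrite Cmod_pow, Hz.
        assert (HSB : Cmod (S z) <= 36 * N).
        { apply Rnot_lt_le. intros Hlt.
          assert (HB : 36 ^ 1 <= (36 * N) ^ n).
          { apply Rle_trans with (36 ^ n); [|apply pow_incr; lra].
            apply Rle_pow; [lra|]. lia. }
          assert (Hp : (36 * N) ^ n < Cmod (S z) ^ n).
          { destruct n as [|n']; [contradiction|]. simpl.
            apply Rle_lt_trans with (36 * N * Cmod (S z) ^ n').
            - apply Rmult_le_compat_l; [lra|]. apply pow_incr. lra.
            - apply Rmult_lt_compat_r; [apply pow_lt; lra|assumption]. }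
          rewrite <- Cmod_pow, HSk in Hp by assumption.
          assert (T := Cmod_triangle (RtoC 1) (- fk z)). rewrite Cmod_opp, Cmod_1 in T.
          destruct (Hbk z Hz) as [Hb _]. unfold Cminus in Hp. lra. }
        replace (2 ^ n) with (/ (1 / 2) ^ n).
        + apply Rmult_le_compat_r; [left; apply Rinv_0_lt_compat, pow_lt; lra|].
          eapply Rle_trans; [apply Cmod_triangle|]. rewrite Cmod_opp, Cmod_1. lra.
        + rewrite <- pow_inv. f_equal. lra. }
    rewrite Cmod_div, Cmod_opp, Cmod_pow, Cmod_R, Rabs_pos_eq, Hck in Hest;
      [|lra|apply Cpow_nz; intros E; injection E; lra].
    apply Rmult_le_compat_r with (r := 2 ^ k) in Hest; [|lra].
    replace (16 * (Cmod c / 16) ^ n / 2 ^ k * 2 ^ k) with (16 * (Cmod c / 16) ^ n) in Hest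
      by (field; lra).
    assert (H2n : 0 < 2 ^ n) by (apply pow_lt; lra).
    apply Rmult_le_reg_r with (2 ^ n); [assumption|].
    rewrite <- Rpow_mult_distr. replace (Cmod c / 32 * 2) with (Cmod c / 16) by field.
    assert (0 <= (Cmod c / 16) ^ n).
    { apply pow_le. assert (H := Cmod_ge_0 c). lra. }
    lra.
Qed.

Theorem hurwitz_bound (f : C -> C) (w p : C) (r : R) (Omega : C -> Prop) :
  hurwitz_family Omega w f r -> ~ Omega p -> r <= 32 * Cmod (w - p).
Proof.
  intros (Hhol & Hmaps & Hf0 & Hfw & Hd & Hr) Hp.
  assert (Hfp : forall z, unit_disc z -> f z <> p).
  { intros z Hz E. apply Hp. rewrite <- E. now apply Hmaps. }
  assert (Hpw : (p - w)%C <> RtoC 0).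
  { apply Cminus_neq_0. intros E. apply (Hfp (RtoC 0) unit_disc_0). now rewrite Hf0. }
  assert (Hder : is_derive f (RtoC 0) (RtoC r)).
  { rewrite <- Hd. apply C_derive_correct; [exact (RtoC 0)|]. apply Hhol, unit_disc_0. }
  assert (H : Cmod (RtoC r / (p - w)) <= 32).
  { apply (hurwitz_omits_one (fun z => (f z - w) / (p - w))%C). repeat split.
    - intros z Hz. apply ex_derive_div_C; [|apply ex_derive_const_C|assumption].
      apply ex_derive_minus_C; [now apply Hhol|apply ex_derive_const_C].
    - rewrite Hf0. field. assumption.
    - intros z Hz Hz0 E. apply (Hfw z Hz Hz0).
      replace (f z) with ((f z - w) / (p - w) * (p - w) + w)%C by (field; assumption).
      rewrite E. ring.
    - intros z Hz E. apply (Hfp z Hz).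
      replace (f z) with ((f z - w) / (p - w) * (p - w) + w)%C by (field; assumption).
      rewrite E. ring.
    - apply is_derive_tends in Hder.
      apply tends_ext_all with (fun z => (f z - f (RtoC 0)) / (z - RtoC 0) / (p - w))%C.
      + intros z Hz. rewrite Hf0. simpl. field. split; [assumption|].
        replace (z - RtoC 0)%C with z by ring. assumption.
      + apply tends_div; [assumption|apply tends_const|assumption]. }
  rewrite Cmod_div, Cmod_R, Rabs_pos_eq in H by (assumption || lra).
  assert (Hpos : 0 < Cmod (p - w)) by now apply Cmod_gt_0.
  apply Rmult_le_compat_r with (r := Cmod (p - w)) in H; [|lra].
  replace (r / Cmod (p - w) * Cmod (p - w)) with r in H by (field; lra).
  replace (Cmod (w - p)) with (Cmod (p - w)); [assumption|].
  rewrite <- Cmod_opp. f_equal. ring.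
Qed.

(** * Comparison of the densities with the distance to the boundary *)

Lemma boundary_distance_spec (Omega : C -> Prop) (w p : C) :
  open Omega -> Omega w -> ~ Omega p ->
  0 < boundary_distance Omega w /\
  (forall q, ~ Omega q -> boundary_distance Omega w <= Cmod (w - q)) /\
  (exists q, ~ Omega q /\ Cmod (w - q) <= 2 * boundary_distance Omega w).
Proof.
  intros Hop Hw Hp.
  set (E := fun d => exists p, ~ Omega p /\ d = Cmod (w - p)%C).
  destruct (Glb_Rbar_correct E) as [Hlb Hglb].
  destruct (proj1 (open_Cmod Omega) Hop w Hw) as (e & He & HeO).
  assert (Hsym : forall q, Cmod (w - q) = Cmod (q - w)).
  { intros q. rewrite <- Cmod_opp. f_equal. ring. }
  assert (H1 : Rbar_le e (Glb_Rbar E)).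
  { apply Hglb. intros d (q & Hq & ->). simpl. apply Rnot_lt_le. intros Hlt.
    apply Hq, HeO. now rewrite <- Hsym. }
  assert (H2 : Rbar_le (Glb_Rbar E) (Cmod (w - p))) by (apply Hlb; now exists p).
  unfold boundary_distance. fold E.
  destruct (Glb_Rbar E) as [d| |] eqn:HE; simpl in H1, H2; try contradiction. simpl.
  split; [lra|]. split.
  - intros q Hq. apply (Hlb (Cmod (w - q))). now exists q.
  - apply NNPP. intros Hno.
    assert (H : Rbar_le (2 * d) d).
    { apply Hglb. intros x (q & Hq & ->). simpl. apply Rnot_lt_le. intros Hlt.
      apply Hno. exists q. split; [assumption|lra]. }
    simpl in H. lra.
Qed.

(** Positivity of the density excludes the default value 0 of its definition and
    thereby provides a covering. *)
Lemma hyperbolic_density_upper_bound (Omega : C -> Prop) (w : C) (d : R) :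
  0 < d -> (forall u, disc w d u -> Omega u) -> 0 < hyperbolic_density Omega w ->
  hyperbolic_density Omega w <= 4 / d.
Proof.
  intros Hd Hdisc. unfold hyperbolic_density.
  destruct (excluded_middle_informative _) as [H|]; [|lra].
  destruct (constructive_indefinite_description _ H) as [l Hl]. simpl. intros Hpos.
  destruct Hl as (f & z & Hf & Hz & Hfz & Hl).
  assert (Hder : is_derive f z (C_derive f z)).
  { apply C_derive_correct; [exact z|]. now apply Hf. }
  assert (Hb := covering_derivative_bound f Omega z _ d Hf Hz Hder Hd).
  rewrite Hfz in Hb. specialize (Hb Hdisc).
  assert (Hz2 : 0 < 1 - Cmod z ^ 2).
  { unfold unit_disc in Hz. generalize (Cmod_ge_0 z). nra. }
  apply Rmult_le_reg_r with d; [assumption|].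
  replace (4 / d * d) with 4 by (field; lra).
  apply Rle_trans with (l * (2 * (1 - Cmod z ^ 2) * Cmod (C_derive f z))).
  - apply Rmult_le_compat_l; lra.
  - replace (l * (2 * (1 - Cmod z ^ 2) * Cmod (C_derive f z)))
      with (2 * (1 - Cmod z ^ 2) * (l * Cmod (C_derive f z))) by ring.
    rewrite Hl. right. field. lra.
Qed.

(** The affine map [w + d z] is a competitor of derivative [d], and Hurwitz's
    theorem bounds all competitors by means of the first puncture alone. *)
Lemma hurwitz_radius_bounds (w1 w2 w : C) (d : R) :
  0 < d -> d <= Cmod (w - w1) -> d <= Cmod (w - w2) ->
  d <= hurwitz_radius (twice_punctured_plane w1 w2) w <= 32 * Cmod (w - w1).
Proof.
  intros Hd H1 H2.
  set (E := fun r => exists f, hurwitz_family (twice_punctured_plane w1 w2) w f r).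
  destruct (Lub_Rbar_correct E) as [Hub Hlub].
  assert (Hderd : forall z, is_derive (fun z => w + RtoC d * z)%C z (RtoC d)).
  { intros z. apply is_C_derive_affine. }
  assert (Hin : E d).
  { exists (fun z => w + RtoC d * z)%C. repeat split.
    - intros z _. eexists. apply Hderd.
    - intros E1. unfold unit_disc in H.
      replace (w - w1)%C with (- (RtoC d * z))%C in H1 by (rewrite <- E1; ring).
      rewrite Cmod_opp, Cmod_mult, Cmod_R, Rabs_pos_eq in H1 by lra. nra.
    - intros E2. unfold unit_disc in H.
      replace (w - w2)%C with (- (RtoC d * z))%C in H2 by (rewrite <- E2; ring).
      rewrite Cmod_opp, Cmod_mult, Cmod_R, Rabs_pos_eq in H2 by lra. nra.
    - ring.
    - intros s _ Hs E3. apply Hs.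
      assert (E4 : (RtoC d * s)%C = RtoC 0).
      { replace (RtoC d * s)%C with (w + RtoC d * s - w)%C by ring. rewrite E3. ring. }
      destruct (Cmult_integral _ _ E4) as [E5|]; [|assumption].
      injection E5. lra.
    - apply is_C_derive_unique, Hderd.
    - assumption. }
  assert (L1 : Rbar_le d (Lub_Rbar E)) by now apply Hub.
  assert (L2 : Rbar_le (Lub_Rbar E) (32 * Cmod (w - w1))).
  { apply Hlub. intros r (f & Hf). simpl.
    apply (hurwitz_bound f w w1 r _ Hf). unfold twice_punctured_plane. tauto. }
  unfold hurwitz_radius. fold E.
  destruct (Lub_Rbar E); simpl in L1, L2 |- *; try contradiction. lra.
Qed.

(** For the lower bound, one puncture is chosen nearly closest to [w]; any other
    point of the complement completes the pair. *)
Lemma eta_bar_bounds (Omega : C -> Prop) (w : C) :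
  hyperbolic_domain Omega -> Omega w ->
  Rbar_le (1 / (32 * boundary_distance Omega w)) (eta_bar Omega w) /\
  Rbar_le (eta_bar Omega w) (2 / boundary_distance Omega w).
Proof.
  intros [(_ & Hop & _) (p & q & Hpq & Hp & Hq)] Hw.
  destruct (boundary_distance_spec Omega w p Hop Hw Hp) as (Hd & Hdist & w1 & Hw1 & Hnear).
  set (d := boundary_distance Omega w) in *.
  set (E := fun h => exists w1 w2 : C, w1 <> w2 /\ ~ Omega w1 /\ ~ Omega w2 /\
    h = hurwitz_density (twice_punctured_plane w1 w2) w).
  unfold eta_bar. fold E. destruct (Lub_Rbar_correct E) as [Hub Hlub]. split.
  - assert (Hw2 : exists w2, w1 <> w2 /\ ~ Omega w2).
    { destruct (classic (w1 = p)) as [->|]; [now exists q|now exists p]. }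
    destruct Hw2 as (w2 & Hw12 & Hw2).
    apply Rbar_le_trans with (hurwitz_density (twice_punctured_plane w1 w2) w).
    + destruct (hurwitz_radius_bounds w1 w2 w d Hd (Hdist _ Hw1) (Hdist _ Hw2)) as [L U].
      unfold hurwitz_density. simpl.
      replace (1 / (32 * d)) with (2 / (64 * d)) by (field; lra).
      apply Rmult_le_compat_l; [lra|]. apply Rinv_le_contravar; lra.
    + apply Hub. exists w1, w2. auto.
  - apply Hlub. intros h (u1 & u2 & _ & Hu1 & Hu2 & ->).
    destruct (hurwitz_radius_bounds u1 u2 w d Hd (Hdist _ Hu1) (Hdist _ Hu2)) as [L _].
    unfold hurwitz_density. simpl.
    apply Rmult_le_compat_l; [lra|]. apply Rinv_le_contravar; lra.
Qed.

Theorem corollary5p3 (Omega : C -> Prop) :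
  hyperbolic_domain Omega ->
  uniformly_perfect_boundary Omega ->
  exists K : R, 1 <= K /\
    forall w : C, Omega w ->
      Rbar_le (Finite (1 / K * hyperbolic_density Omega w)) (eta_bar Omega w) /\
      Rbar_le (eta_bar Omega w) (Finite (K * hyperbolic_density Omega w)).
Proof.
  intros Hhyp (b & Hb & Hperf).
  (* [128 = 4 * 32] compares [4 / d] with [1 / (32 d)], and [2 / b] compares
     [2 / d] with [b / d]. *)
  exists (Rmax 128 (2 / b)).
  assert (K1 := Rmax_l 128 (2 / b)). assert (K2 := Rmax_r 128 (2 / b)).
  set (K := Rmax 128 (2 / b)) in *. clearbody K. split; [lra|].
  intros w Hw. destruct (eta_bar_bounds Omega w Hhyp Hw) as [Hlow Hup].
  destruct Hhyp as [(_ & Hop & _) (p & _ & _ & Hp & _)].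
  destruct (boundary_distance_spec Omega w p Hop Hw Hp) as (Hd & Hdist & _).
  specialize (Hperf w Hw).
  set (d := boundary_distance Omega w) in *.
  set (lam := hyperbolic_density Omega w) in *.
  assert (Hbd : 0 < b / d) by now apply Rdiv_lt_0_compat.
  assert (Hlam : 0 < lam) by lra.
  assert (Hlam4 : lam <= 4 / d).
  { apply hyperbolic_density_upper_bound; try assumption.
    intros u Hu. apply NNPP. intros HNu. specialize (Hdist u HNu).
    unfold disc in Hu. rewrite <- Cmod_opp in Hu.
    replace (- (u - w))%C with (w - u)%C in Hu by ring. lra. }
  split.
  - apply Rbar_le_trans with (1 / (32 * d)); [|assumption]. simpl.
    apply Rmult_le_reg_r with (128 * d); [lra|].
    replace (1 / (32 * d) * (128 * d)) with 4 by (field; lra).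
    assert (H4 : lam * d <= 4).
    { apply Rmult_le_compat_r with (r := d) in Hlam4; [|lra].
      now replace (4 / d * d) with 4 in Hlam4 by (field; lra). }
    replace (1 / K * lam * (128 * d)) with (lam * d * (128 / K)) by (field; lra).
    assert (HK : 128 / K <= 1).
    { apply Rmult_le_reg_r with K; [lra|]. replace (128 / K * K) with 128 by (field; lra). lra. }
    assert (0 < lam * d) by now apply Rmult_lt_0_compat.
    assert (lam * d * (128 / K) <= lam * d * 1) by (apply Rmult_le_compat_l; lra). lra.
  - apply Rbar_le_trans with (2 / d); [assumption|]. simpl.
    apply Rle_trans with (2 / b * lam); [|apply Rmult_le_compat_r; lra].
    replace (2 / d) with (2 / b * (b / d)) by (field; lra).
    apply Rmult_le_compat_l; [|lra]. left. apply Rdiv_lt_0_compat; lra.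
Qed.
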